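(* Suppose each $f_i$ is convex and differentiable with $(1/\gamma_i)$-Lipschitz continuous gradient and $g$ is $\lambda$-strongly convex, and let $(w^\star,\alpha^\star)$ be the unique saddle point of $L(w,\alpha)$. Let $\Gamma$ be a constant that satisfies $$\Gamma \ge \max_{i,k}\left\{ \frac{1}{p_i}\left(1+\frac{9\|X_{ik}\|^2}{2 q_k \lambda\gamma_i}\right),\ \frac{1}{q_k}\left(1+\frac{9n\|X_{ik}\|^2}{2 p_i m\lambda\gamma_i}\right),\ \frac{1}{p_iq_k}\right\}.$$ If we choose the step sizes as $$\sigma_i = \frac{1}{2\gamma_i(p_i\Gamma-1)},\quad i=1,\ldots,m,\qquad \tau_k = \frac{1}{2\lambda(q_k\Gamma-1)},\quad k=1,\ldots,n,$$ then the iterates of the DSCOVR-SAGA algorithm (described in the context) satisfy, for $t=1,2,\ldots$, $$\mathbf{E}\left[\Omega\bigl(w^{(t)}-w^\star,\alpha^{(t)}-\alpha^\star\bigr)\right]\le\left(1-\frac{1}{3\Gamma}\right)^{t}\frac43\,\Omega\bigl(w^{(0)}-w^\star,\alpha^{(0)}-\alpha^\star\bigr).$$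
   Context: Setting. $m,n,N_1,\ldots,N_m,d_1,\ldots,d_n$ are positive integers, $N=\sum_i N_i$, $d=\sum_k d_k$. Vectors $w\in\mathbb{R}^d$ are partitioned as $w=[w_1;\ldots;w_n]$ with $w_k\in\mathbb{R}^{d_k}$, and $\alpha\in\mathbb{R}^N$ as $\alpha=[\alpha_1;\ldots;\alpha_m]$ with $\alpha_i\in\mathbb{R}^{N_i}$. The matrix $X\in\mathbb{R}^{N\times d}$ is partitioned conformally into blocks $X_{ik}\in\mathbb{R}^{N_i\times d_k}$; $X_{i:}\in\mathbb{R}^{N_i\times d}$ denotes the $i$-th block row and $X_{:k}\in\mathbb{R}^{N\times d_k}$ the $k$-th block column. Given are functions $f_i:\mathbb{R}^{N_i}\to\mathbb{R}$ and $g(w)=\sum_{k=1}^n g_k(w_k)$ with $g_k:\mathbb{R}^{d_k}\to\mathbb{R}$, and constants $\lambda>0$, $\gamma_i>0$. $f_i^*(\alpha_i)=\sup_{u}\{\alpha_i^Tu-f_i(u)\}$ is the convex conjugate, and $$L(w,\alpha)=\frac1m\sum_{i=1}^m\alpha_i^TX_{i:}w-\frac1m\sum_{i=1}^m f_i^*(\alpha_i)+g(w).$$ $\lambda$-strong convexity of $g$ means $g(w')\ge g(w)+\xi^T(w'-w)+\frac\lambda2\|w'-w\|^2$ for all $w,w'$ and $\xi\in\partial g(w)$. A saddle point satisfies $L(w^\star,\alpha)\le L(w^\star,\alpha^\star)\le L(w,\alpha^\star)$ for all $(w,\alpha)$; under the stated assumptions on $f_i,g$ it exists and is unique. Norms: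 $\|\cdot\|$ is the Euclidean norm for vectors and the spectral norm for matrices. Define $\Omega(w,\alpha)=\lambda\|w\|^2+\frac1m\sum_{i=1}^m\gamma_i\|\alpha_i\|^2$. The proximal mapping is $\mathbf{prox}_\phi(v)=\arg\min_u\{\phi(u)+\frac12\|u-v\|^2\}$. $p=(p_1,\ldots,p_m)$ and $q=(q_1,\ldots,q_n)$ are probability distributions with all $p_i,q_k>0$; the step sizes $\sigma_i,\tau_k$ are understood to be positive finite numbers (i.e. $p_i\Gamma>1$, $q_k\Gamma>1$). DSCOVR-SAGA algorithm. Input: deterministic initial points $w^{(0)}\in\mathbb{R}^d$, $\alpha^{(0)}\in\mathbb{R}^N$. Initialize $\bar u^{(0)}=Xw^{(0)}$, $\bar v^{(0)}=\frac1mX^T\alpha^{(0)}$ (partitioned like $\alpha$ and $w$), and $U_{ik}^{(0)}=X_{ik}w_k^{(0)}\in\mathbb{R}^{N_i}$, $V_{ik}^{(0)}=\frac1m(\alpha_i^{(0)})^TX_{ik}\in\mathbb{R}^{1\times d_k}$ for all $i,k$. For $t=0,1,2,\ldots$: pick $j\in\{1,\ldots,m\}$ with distribution $p$ and $l\in\{1,\ldots,n\}$ with distribution $q$, independently of each other and of the past; compute $$u_j^{(t+1)}=\bar u_j^{(t)}-\tfrac1{q_l}U_{jl}^{(t)}+\tfrac1{q_l}X_{jl}w_l^{(t)},\qquad v_l^{(t+1)}=\bar v_l^{(t)}-\tfrac1{p_j}(V_{jl}^{(t)})^T+\tfrac1{p_j}\tfrac1mX_{jl}^T\alpha_j^{(t)};$$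 set $\alpha_j^{(t+1)}=\mathbf{prox}_{\sigma_jf_j^*}(\alpha_j^{(t)}+\sigma_ju_j^{(t+1)})$ and $\alpha_i^{(t+1)}=\alpha_i^{(t)}$ for $i\ne j$; set $w_l^{(t+1)}=\mathbf{prox}_{\tau_lg_l}(w_l^{(t)}-\tau_lv_l^{(t+1)})$ and $w_k^{(t+1)}=w_k^{(t)}$ for $k\ne l$; set $\bar u_j^{(t+1)}=\bar u_j^{(t)}-U_{jl}^{(t)}+X_{jl}w_l^{(t)}$ and $\bar u_i^{(t+1)}=\bar u_i^{(t)}$ for $i\neq j$; set $\bar v_l^{(t+1)}=\bar v_l^{(t)}-(V_{jl}^{(t)})^T+\frac1mX_{jl}^T\alpha_j^{(t)}$ and $\bar v_k^{(t+1)}=\bar v_k^{(t)}$ for $k\ne l$; finally set $U_{jl}^{(t+1)}=X_{jl}w_l^{(t)}$, $V_{jl}^{(t+1)}=\frac1m(X_{jl}^T\alpha_j^{(t)})^T$, and leave all other blocks of $U,V$ unchanged. The expectation $\mathbf{E}$ is over all random indices. *)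

(* Defs.v *)
From HB Require Import structures.
From mathcomp Require Export all_boot all_order all_algebra finmap.
From mathcomp Require Export all_classical all_reals all_analysis.
Export numFieldNormedType.Exports.

Set Implicit Arguments.
Unset Strict Implicit.
Unset Printing Implicit Defensive.

Import Order.TTheory GRing.Theory Num.Theory.

Local Open Scope classical_set_scope.
Local Open Scope ring_scope.

(* The library norm `|x| on matrices is the maximum norm, hence the explicit
   Euclidean and spectral norms below. *)
Definition dotc (R : realType) (n : nat) (x y : 'cV[R]_n) : R :=
  (x^T *m y) 0 0.

Definition norm2 (R : realType) (n : nat) (x : 'cV[R]_n) : R :=
  Num.sqrt (dotc x x).

Definition spectral_norm (R : realType) (a b : nat) (A : 'M[R]_(a, b)) : R :=
  sup [set norm2 (A *m x) | x in [set x : 'cV[R]_b | norm2 x <= 1]].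

Definition gradient (R : realType) (n : nat) (f : 'cV[R]_n -> R)
    (x : 'cV[R]_n) : 'cV[R]_n :=
  \col_i 'D_(delta_mx i 0) f x.

Definition convex (R : realType) (n : nat) (f : 'cV[R]_n -> R) : Prop :=
  convex_function (E := 'cV[R]_n) setT f.

Definition smooth (R : realType) (n : nat) (K : R) (f : 'cV[R]_n -> R) : Prop :=
  (forall x, differentiable f x) /\
  (forall x y, norm2 (gradient f x - gradient f y) <= K * norm2 (x - y)).

Definition subdifferential (R : realType) (n : nat) (g : 'cV[R]_n -> R)
    (w : 'cV[R]_n) : set 'cV[R]_n :=
  [set xi | forall w', g w + dotc xi (w' - w) <= g w'].

(* Convexity is required explicitly: the subgradient inequality is void at
   points where the subdifferential is empty. *)
Definition strongly_convex (R : realType) (n : nat) (lambda : R)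
    (g : 'cV[R]_n -> R) : Prop :=
  convex g /\
  forall w w' xi, subdifferential g w xi ->
    g w + dotc xi (w' - w) + lambda / 2 * norm2 (w' - w) ^+ 2 <= g w'.

Definition conjugate (R : realType) (n : nat) (f : 'cV[R]_n -> R)
    (a : 'cV[R]_n) : \bar R :=
  ereal_sup [set (dotc a u - f u)%:E | u in [set: 'cV[R]_n]].

Definition argmin (R : realType) (T : Type) (phi : T -> \bar R) : set T :=
  [set u | forall u', (phi u <= phi u')%E].

Definition prox (R : realType) (n : nat) (phi : 'cV[R]_n -> \bar R)
    (v : 'cV[R]_n) : 'cV[R]_n :=
  xget 0 (argmin (fun u => phi u + (2^-1 * norm2 (u - v) ^+ 2)%:E)%E).

Definition separable (R : realType) (n : nat) (d : 'I_n -> nat)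
    (g : forall k, 'cV[R]_(d k) -> R) (w : 'cV[R]_(\sum_k d k)) : R :=
  \sum_k g k (submxcol w k).

Definition lagrangian (R : realType) (m n : nat) (N : 'I_m -> nat)
    (d : 'I_n -> nat) (X : 'M[R]_(\sum_i N i, \sum_k d k))
    (f : forall i, 'cV[R]_(N i) -> R) (g : forall k, 'cV[R]_(d k) -> R)
    (w : 'cV[R]_(\sum_k d k)) (alpha : 'cV[R]_(\sum_i N i)) : \bar R :=
  ((m%:R^-1 * \sum_i dotc (submxcol alpha i) (submxcol X i *m w))%:E
   - (m%:R^-1)%:E * (\sum_i conjugate (f i) (submxcol alpha i))
   + (separable g w)%:E)%E.

Definition saddle_point (R : realType) (V W : Type) (L : V -> W -> \bar R)
    (w0 : V) (a0 : W) : Prop :=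
  forall w a, (L w0 a <= L w0 a0 <= L w a0)%E.

Definition Omega (R : realType) (m n : nat) (N : 'I_m -> nat) (d : 'I_n -> nat)
    (lambda : R) (gamma : 'I_m -> R)
    (w : 'cV[R]_(\sum_k d k)) (alpha : 'cV[R]_(\sum_i N i)) : R :=
  lambda * norm2 w ^+ 2
  + m%:R^-1 * \sum_i gamma i * norm2 (submxcol alpha i) ^+ 2.

Definition set_block (R : realType) (n : nat) (d : 'I_n -> nat)
    (w : 'cV[R]_(\sum_k d k)) (l : 'I_n) (y : 'cV[R]_(d l)) :
    'cV[R]_(\sum_k d k) :=
  \mxcol_k dfwith (submxcol w) l y k.

Record saga_state (R : realType) (m n : nat) (N : 'I_m -> nat)
    (d : 'I_n -> nat) := SagaState {
  sg_w : 'cV[R]_(\sum_k d k);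
  sg_alpha : 'cV[R]_(\sum_i N i);
  sg_ubar : 'cV[R]_(\sum_i N i);
  sg_vbar : 'cV[R]_(\sum_k d k);
  sg_U : forall i : 'I_m, 'I_n -> 'cV[R]_(N i);
  sg_V : 'I_m -> forall k : 'I_n, 'rV[R]_(d k)
}.

Definition saga_init (R : realType) (m n : nat) (N : 'I_m -> nat)
    (d : 'I_n -> nat) (X : 'M[R]_(\sum_i N i, \sum_k d k))
    (w0 : 'cV[R]_(\sum_k d k)) (alpha0 : 'cV[R]_(\sum_i N i)) :
    saga_state R N d :=
  {| sg_w := w0;
     sg_alpha := alpha0;
     sg_ubar := X *m w0;
     sg_vbar := m%:R^-1 *: (X^T *m alpha0);
     sg_U := fun i k => submxblock X i k *m submxcol w0 k;
     sg_V := fun i k =>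
       m%:R^-1 *: ((submxcol alpha0 i)^T *m submxblock X i k) |}.

Definition saga_step (R : realType) (m n : nat) (N : 'I_m -> nat)
    (d : 'I_n -> nat) (X : 'M[R]_(\sum_i N i, \sum_k d k))
    (f : forall i, 'cV[R]_(N i) -> R) (g : forall k, 'cV[R]_(d k) -> R)
    (p : 'I_m -> R) (q : 'I_n -> R) (sigma : 'I_m -> R) (tau : 'I_n -> R)
    (s : saga_state R N d) (j : 'I_m) (l : 'I_n) : saga_state R N d :=
  let: SagaState w alpha ubar vbar U V := s in
  let Xw := submxblock X j l *m submxcol w l in
  let Xa := m%:R^-1 *: ((submxblock X j l)^T *m submxcol alpha j) in
  let u := submxcol ubar j - (q l)^-1 *: U j l + (q l)^-1 *: Xw in
  let v := submxcol vbar l - (p j)^-1 *: (V j l)^T + (p j)^-1 *: Xa in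
  {| sg_w := set_block w
       (prox (fun y => (tau l * g l y)%:E) (submxcol w l - tau l *: v));
     sg_alpha := set_block alpha
       (prox (fun y => (sigma j)%:E * conjugate (f j) y)%E
             (submxcol alpha j + sigma j *: u));
     sg_ubar := set_block ubar (submxcol ubar j - U j l + Xw);
     sg_vbar := set_block vbar (submxcol vbar l - (V j l)^T + Xa);
     sg_U := dfwith U j (dfwith (U j) l Xw);
     sg_V := dfwith V j (dfwith (V j) l Xa^T) |}.

Fixpoint saga_iter (R : realType) (m n : nat) (N : 'I_m -> nat)
    (d : 'I_n -> nat) (X : 'M[R]_(\sum_i N i, \sum_k d k))
    (f : forall i, 'cV[R]_(N i) -> R) (g : forall k, 'cV[R]_(d k) -> R)
    (p : 'I_m -> R) (q : 'I_n -> R) (sigma : 'I_m -> R) (tau : 'I_n -> R)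
    (w0 : 'cV[R]_(\sum_k d k)) (alpha0 : 'cV[R]_(\sum_i N i))
    (J : nat -> 'I_m) (K : nat -> 'I_n) (t : nat) : saga_state R N d :=
  if t is t'.+1 then
    saga_step X f g p q sigma tau
      (saga_iter X f g p q sigma tau w0 alpha0 J K t') (J t') (K t')
  else saga_init X w0 alpha0.

Definition mutually_independent (disp : measure_display)
    (T : measurableType disp) (R : realType) (P : probability T R)
    (I : choiceType) (E : I -> set (set T)) : Prop :=
  forall (F : {fset I}) (A : I -> set T), (forall i, i \in F -> E i (A i)) ->
    P (\bigcap_(i in [set` F]) A i) = (\prod_(i <- F) P (A i))%E.

(* The sigma-algebra generated by a variable with values in a finite set, all
   of whose subsets are measurable. *)
Definition events_of (T : Type) (I : finType) (Y : T -> I) : set (set T) :=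
  [set Y @^-1` B | B in [set: set I]].

Definition index_events (T : Type) (m n : nat) (J : nat -> T -> 'I_m)
    (K : nat -> T -> 'I_n) (s : nat + nat) : set (set T) :=
  match s with inl t => events_of (J t) | inr t => events_of (K t) end.

Definition index_sampling (disp : measure_display) (T : measurableType disp)
    (R : realType) (P : probability T R) (m n : nat)
    (p : 'I_m -> R) (q : 'I_n -> R)
    (J : nat -> T -> 'I_m) (K : nat -> T -> 'I_n) : Prop :=
  [/\ forall s, index_events J K s `<=` measurable,
      forall t i, P (J t @^-1` [set i]) = (p i)%:E,
      forall t k, P (K t @^-1` [set k]) = (q k)%:E &
      mutually_independent P (index_events J K)].

Definition distribution_on (R : realType) (n : nat) (p : 'I_n -> R) : Prop :=
  (forall i, 0 < p i) /\ \sum_i p i = 1.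

(* Main.v *)
(* At the saddle point alpha*_i is the gradient of f_i at X_i w*, and minus the
   k-th block of X^T alpha* / m is a subgradient of g_k at w*_k.  Cocoercivity of
   the gradient of f_i, strong convexity of g_k and the optimality conditions of
   the two proximal steps bound the new block errors by the old ones, plus cross
   terms that cancel in the mean because the SAGA estimators are unbiased, plus
   the variance of the estimators.  That variance is split into the current error,
   which the lower bounds on Gamma make small, and the error of the stored tables
   U and V; adding a multiple of the table errors to Gamma Omega gives a Lyapunov
   function whose conditional mean contracts by 1 - 1 / (3 Gamma) and which is
   at most 4/3 Gamma Omega initially, since the tables start at the current point.
   The expectation itself is a finite sum over the sequences of drawn indices. *)

(* [prox] is an arbitrary choice among minimisers with default 0, so a proximal step says nothing
   until a minimiser is shown to exist. For [g k] existence rests on an affine minorant, which makes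
   the proximal objective coercive, and on the continuity of finite convex functions. For
   [conjugate (f i)], which may take the value +oo, the minimiser is not sought directly: it is read
   off from the proximal point of [f i] itself. No general theorem on the existence of subgradients
   is invoked: gradients supply them for [f i], and the saddle point supplies one for each [g k]; a
   single one is enough for coercivity.

   Block [i] moves only with probability [p i], and a table entry only with probability [p i * q k].
   The step sizes and the table weights undo these probabilities: the mean recursion for every block
   has the same factor [Gamma - 1], and the weighted table error changes in the mean by exactly the
   fresh error minus the stored one. Everything probabilistic is thereby reduced to the mean over a
   single draw from an arbitrary state whose running sums agree with its tables. *)
Require Import Defs.
From mathcomp Require Import ring lra measurable_realfun.

Set Implicit Arguments.
Unset Strict Implicit.
Unset Printing Implicit Defensive.

Import Order.TTheory GRing.Theory Num.Theory.

Local Open Scope classical_set_scope.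
Local Open Scope ring_scope.

(** * Inner products, norms and blocks *)

Section dotc_theory.
Context {R : realType}.

Lemma dotcE n (x y : 'cV[R]_n) : dotc x y = \sum_i x i 0 * y i 0.
Proof. by rewrite /dotc mxE; apply: eq_bigr => i _; rewrite mxE. Qed.

Lemma dotcC n (x y : 'cV[R]_n) : dotc x y = dotc y x.
Proof. by rewrite !dotcE; apply: eq_bigr => i _; rewrite mulrC. Qed.

Lemma dotcDl n (x y z : 'cV[R]_n) : dotc (x + y) z = dotc x z + dotc y z.
Proof. by rewrite /dotc linearD mulmxDl mxE. Qed.

Lemma dotcDr n (x y z : 'cV[R]_n) : dotc z (x + y) = dotc z x + dotc z y.
Proof. by rewrite /dotc mulmxDr mxE. Qed.

Lemma dotcZl n a (x y : 'cV[R]_n) : dotc (a *: x) y = a * dotc x y.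
Proof. by rewrite /dotc linearZ -scalemxAl mxE. Qed.

Lemma dotcZr n a (x y : 'cV[R]_n) : dotc x (a *: y) = a * dotc x y.
Proof. by rewrite dotcC dotcZl dotcC. Qed.

Lemma dotcNl n (x y : 'cV[R]_n) : dotc (- x) y = - dotc x y.
Proof. by rewrite -scaleN1r dotcZl mulN1r. Qed.

Lemma dotcNr n (x y : 'cV[R]_n) : dotc x (- y) = - dotc x y.
Proof. by rewrite dotcC dotcNl dotcC. Qed.

Lemma dotc0l n (x : 'cV[R]_n) : dotc 0 x = 0.
Proof. by rewrite -(scale0r 0) dotcZl mul0r. Qed.

Lemma dotc0r n (x : 'cV[R]_n) : dotc x 0 = 0.
Proof. by rewrite dotcC dotc0l. Qed.

(** Expands an inner product into products of atomic vectors, which [lra] then treats as unknowns;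
    symmetric pairs are merged by [dotcC]. *)
Definition dotc_lin := (dotcDl, dotcDr, dotcNl, dotcNr, dotcZl, dotcZr).

Lemma dotc_suml n (I : finType) (F : I -> 'cV[R]_n) x :
  dotc (\sum_i F i) x = \sum_i dotc (F i) x.
Proof.
by apply: (big_morph (fun y => dotc y x)) => [y z|]; rewrite ?dotcDl ?dotc0l.
Qed.

Lemma dotc_ge0 n (x : 'cV[R]_n) : 0 <= dotc x x.
Proof. by rewrite dotcE sumr_ge0// => i _; rewrite -expr2 sqr_ge0. Qed.

Lemma dotc_eq0 n (x : 'cV[R]_n) : dotc x x = 0 -> x = 0.
Proof.
rewrite dotcE => /psumr_eq0P x0; apply/matrixP => i j; rewrite ord1 mxE.
by apply/eqP; rewrite -[_ == 0]orbb -mulf_eq0 x0// => k _; rewrite -expr2 sqr_ge0.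
Qed.

Lemma dotc_mulmx a b (A : 'M[R]_(a, b)) x y :
  dotc x (A *m y) = dotc (A^T *m x) y.
Proof. by rewrite /dotc trmx_mul trmxK mulmxA. Qed.

Lemma dotc_le_entry n (x : 'cV[R]_n) i : x i 0 ^+ 2 <= dotc x x.
Proof.
rewrite dotcE (bigD1 i)//= expr2 lerDl sumr_ge0// => j _.
by rewrite -expr2 sqr_ge0.
Qed.

Lemma norm2_sqr n (x : 'cV[R]_n) : norm2 x ^+ 2 = dotc x x.
Proof. by rewrite sqr_sqrtr// dotc_ge0. Qed.

Lemma norm2_ge0 n (x : 'cV[R]_n) : 0 <= norm2 x.
Proof. exact: sqrtr_ge0. Qed.

Lemma norm2_0 n : norm2 (0 : 'cV[R]_n) = 0.
Proof. by rewrite /norm2 dotc0l sqrtr0. Qed.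

Lemma norm2Z n a (x : 'cV[R]_n) : norm2 (a *: x) = `|a| * norm2 x.
Proof.
by rewrite /norm2 dotcZl dotcZr mulrA -expr2 sqrtrM ?sqr_ge0// sqrtr_sqr.
Qed.

Lemma norm2_eq0 n (x : 'cV[R]_n) : norm2 x = 0 -> x = 0.
Proof. by move=> x0; apply: dotc_eq0; rewrite -norm2_sqr x0 expr0n. Qed.

(** Cauchy-Schwarz: expand the square of |y| x - |x| y and divide by |x| |y|. *)
Lemma dotc_le_norm2 n (x y : 'cV[R]_n) : dotc x y <= norm2 x * norm2 y.
Proof.
have [/norm2_eq0 ->|x0] := eqVneq (norm2 x) 0.
  by rewrite dotc0l norm2_0 mul0r.
have [/norm2_eq0 ->|y0] := eqVneq (norm2 y) 0.
  by rewrite dotc0r norm2_0 mulr0.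
have {x0} x0 : 0 < norm2 x by rewrite lt_def x0 norm2_ge0.
have {y0} y0 : 0 < norm2 y by rewrite lt_def y0 norm2_ge0.
have := dotc_ge0 (norm2 y *: x - norm2 x *: y).
rewrite !dotc_lin -!norm2_sqr (dotcC y x) => h.
rewrite -(@ler_pM2l _ (norm2 x * norm2 y)) ?mulr_gt0//; lra.
Qed.

(** This is the square of x - 2 c y. In the proximal steps [y] is the displacement, and its term is
    absorbed by the quadratic penalty. *)
Lemma dotc_young n (c : R) (x y : 'cV[R]_n) : 0 < c ->
  dotc x y <= c * dotc y y + (4 * c)^-1 * dotc x x.
Proof.
move=> c0; have := dotc_ge0 (x - (2 * c) *: y).
rewrite !dotc_lin (dotcC y x) => h.
rewrite -(@ler_pM2l _ (4 * c)) ?mulr_gt0// mulrDr [in X in _ <= _ + X]mulrA.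
rewrite divff ?mul1r; last first.
  by rewrite mulf_neq0// gt_eqF.
lra.
Qed.

Lemma dotc_sub_le n (x y : 'cV[R]_n) :
  dotc (x - y) (x - y) <= 2 * dotc x x + 2 * dotc y y.
Proof.
by have := dotc_ge0 (x + y); rewrite !dotc_lin (dotcC y x); lra.
Qed.

(** The Frobenius norm serves as the bound; it shows that the supremum in [spectral_norm] is over a
    bounded set. *)
Lemma norm2_mulmx_bound a b (A : 'M[R]_(a, b)) :
  exists C, forall x, norm2 (A *m x) <= C * norm2 x.
Proof.
exists (Num.sqrt (\sum_i dotc (row i A)^T (row i A)^T)) => x.
rewrite /norm2 -sqrtrM; last by rewrite sumr_ge0// => i _; exact: dotc_ge0.
rewrite ler_wsqrtr// dotcE mulr_suml ler_sum// => i _.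
have -> : (A *m x) i 0 = dotc (row i A)^T x.
  by rewrite /dotc trmxK -row_mul [RHS]mxE.
rewrite -expr2 -!norm2_sqr -exprMn -[_ ^+ 2]ger0_norm ?sqr_ge0// normrX.
rewrite lerXn2r ?nnegrE ?mulr_ge0 ?norm2_ge0// ler_norml dotc_le_norm2 andbT.
rewrite lerNl -dotcNl (le_trans (dotc_le_norm2 _ _))//.
by rewrite -scaleN1r norm2Z normrN1 mul1r.
Qed.

Lemma norm2_spectral a b (A : 'M[R]_(a, b)) x :
  norm2 (A *m x) <= spectral_norm A * norm2 x.
Proof.
have [C hC] := norm2_mulmx_bound A.
have ubA : has_ubound [set norm2 (A *m x) | x in [set x : 'cV[R]_b | norm2 x <= 1]].
  exists `|C| => _ [y /= y1 <-]; rewrite (le_trans (hC y))//.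
  rewrite (le_trans (ler_wpM2r (norm2_ge0 _) (ler_norm _)))//.
  by rewrite ler_piMr.
have [/norm2_eq0 ->|x0] := eqVneq (norm2 x) 0.
  by rewrite mulmx0 !norm2_0 mulr0.
have {}x0 : 0 < norm2 x by rewrite lt_def x0 norm2_ge0.
rewrite -ler_pdivrMr// mulrC -[_^-1]ger0_norm ?invr_ge0 ?norm2_ge0//.
rewrite -norm2Z scalemxAr; apply: (ub_le_sup ubA).
exists ((norm2 x)^-1 *: x) => //=.
by rewrite norm2Z ger0_norm ?invr_ge0 ?norm2_ge0// mulVf ?gt_eqF.
Qed.

Lemma spectral_norm_ge0 a b (A : 'M[R]_(a, b)) : 0 <= spectral_norm A.
Proof.
have [C hC] := norm2_mulmx_bound A.
apply: ub_le_sup; last by exists 0; rewrite /= ?mulmx0 norm2_0.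
exists `|C| => _ [y /= y1 <-]; rewrite (le_trans (hC y))//.
by rewrite (le_trans (ler_wpM2r (norm2_ge0 _) (ler_norm _)))// ler_piMr.
Qed.

Lemma dotc_spectral a b (A : 'M[R]_(a, b)) x :
  dotc (A *m x) (A *m x) <= spectral_norm A ^+ 2 * dotc x x.
Proof.
rewrite -!norm2_sqr -exprMn lerXn2r ?nnegrE ?norm2_ge0 ?norm2_spectral//.
by rewrite mulr_ge0 ?norm2_ge0 ?spectral_norm_ge0.
Qed.

(** With y = A^T x, |y|^2 = x . A y is at most |x| |A| |y|; cancelling |y| bounds the transpose
    without a separate study of its spectral norm. *)
Lemma dotc_spectral_tr a b (A : 'M[R]_(a, b)) x :
  dotc (A^T *m x) (A^T *m x) <= spectral_norm A ^+ 2 * dotc x x.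
Proof.
rewrite -!norm2_sqr -exprMn; apply: lerXn2r;
  rewrite ?nnegrE ?mulr_ge0 ?norm2_ge0 ?spectral_norm_ge0//.
have [->|x0] := eqVneq (norm2 (A^T *m x)) 0.
  by rewrite mulr_ge0 ?norm2_ge0 ?spectral_norm_ge0.
have {}x0 : 0 < norm2 (A^T *m x) by rewrite lt_def x0 norm2_ge0.
rewrite -(ler_pM2r x0) -expr2 norm2_sqr -dotc_mulmx.
rewrite (le_trans (dotc_le_norm2 _ _))// mulrC mulrAC ler_wpM2r ?norm2_ge0//.
exact: norm2_spectral.
Qed.

Lemma dotc_blocks n (d : 'I_n -> nat) (x y : 'cV[R]_(\sum_k d k)) :
  dotc x y = \sum_k dotc (submxcol x k) (submxcol y k).
Proof.
rewrite {1}/dotc -{1}(submxcolK x) -{1}(submxcolK y) tr_mxcol mul_mxrow_mxcol.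
by rewrite summxE.
Qed.

Lemma submxcol_mulmx m n (N : 'I_m -> nat) (d : 'I_n -> nat)
    (X : 'M[R]_(\sum_i N i, \sum_k d k)) (w : 'cV_(\sum_k d k)) i :
  submxcol X i *m w = \sum_k submxblock X i k *m submxcol w k.
Proof.
rewrite -{1}(submxrowK (submxcol X i)) -{1}(submxcolK w) mul_mxrow_mxcol.
by apply: eq_bigr => k _; rewrite submxblockEv.
Qed.

Lemma submxcol_trmulmx m n (N : 'I_m -> nat) (d : 'I_n -> nat)
    (X : 'M[R]_(\sum_i N i, \sum_k d k)) (a : 'cV_(\sum_i N i)) k :
  submxcol (X^T *m a) k = \sum_i (submxblock X i k)^T *m submxcol a i.
Proof.
rewrite -submxcol_mul submxcol_mulmx; apply: eq_bigr => i _; congr (_ *m _).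
by apply/matrixP => r s; rewrite !mxE.
Qed.

Lemma submxcol_set_block n (d : 'I_n -> nat) (w : 'cV[R]_(\sum_k d k)) l
    (y : 'cV[R]_(d l)) k :
  submxcol (set_block w y) k = dfwith (submxcol w) l y k.
Proof. by rewrite mxcolK. Qed.

End dotc_theory.

(** * Convex functions *)

Section limits.
Context {R : realType}.

Lemma ge0_add_small (a b : R) :
  (forall t, 0 < t -> t <= 1 -> 0 <= a + t * b) -> 0 <= a.
Proof.
move=> h; rewrite leNgt; apply/negP => a0.
have b1 : 0 < `|b| + 1 by rewrite ltr_wpDl.
(* Small enough that t |b| stays below - a / 2, so that a + t b would be negative. *)
pose t := Num.min 1 (- a / (2 * (`|b| + 1))).
have t0 : 0 < t by rewrite lt_min ltr01 divr_gt0 ?oppr_gt0 ?mulr_gt0.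
have t1 : t <= 1 by rewrite ge_min lexx.
have : t * (2 * (`|b| + 1)) <= - a.
  by rewrite -ler_pdivlMr ?mulr_gt0// ge_min lexx orbT.
have := h _ t0 t1; have : t * b <= t * `|b| by rewrite ler_wpM2l ?ler_norm ?ltW.
lra.
Qed.

Lemma ge0_add_half_pow (a b : R) :
  (forall k : nat, 0 <= a + b / 2 ^+ k) -> 0 <= a.
Proof.
move=> h; apply: (@ge0_add_small a `|b|) => t t0 t1.
have [k tk] : exists k : nat, (2 ^+ k)^-1 <= t.
  exists (Num.truncn t^-1).+1.
  rewrite -[leRHS]invrK lef_pV2 ?posrE ?exprn_gt0 ?invr_gt0//.
  apply/ltW/(lt_trans (truncnS_gt _)).
  by rewrite -natrX ltr_nat ltn_expl.
have := h k; rewrite mulrC => /le_trans; apply; rewrite lerD2l.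
rewrite (@le_trans _ _ ((2 ^+ k)^-1 * `|b|))//.
  by rewrite ler_wpM2l ?ler_norm// invr_ge0 exprn_ge0.
by rewrite ler_wpM2r.
Qed.

End limits.

Section convexity.
Context {R : realType} {n : nat}.
Implicit Types (h : 'cV[R]_n -> R) (x y z c xi : 'cV[R]_n).

Lemma convexP h : convex h <->
  forall t x y, 0 <= t -> t <= 1 ->
    h (t *: x + (1 - t) *: y) <= t * h x + (1 - t) * h y.
Proof.
split=> [ch t x y t0 t1|ch t x y _ _].
  have := ch (@Itv01 _ t t0 t1) x y; rewrite !inE => /(_ I I).
  by rewrite convRE.
by rewrite convRE; apply: ch => //=.
Qed.

Lemma convex_line h x y (t : R) : convex h -> 0 <= t -> t <= 1 ->
  h (x + t *: y) <= h x + t * (h (x + y) - h x).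
Proof.
move=> /convexP ch t0 t1; have := ch t (x + y) x t0 t1.
have -> : t *: (x + y) + (1 - t) *: x = x + t *: y.
  by rewrite scalerDr scalerBl scale1r addrC addrA subrK.
by move=> /le_trans; apply; lra.
Qed.

(** Induction on the coordinates: x + u_i e_i + rest is the midpoint of x + 2 u_i e_i and x + 2
    rest, so control along the axes suffices; the admissible radius is halved each time. *)
Lemma convex_near_le h x (s : seq 'I_n) (e : R) : convex h -> 0 < e ->
  exists2 dlt, 0 < dlt & forall u : 'cV[R]_n, (forall i, `|u i 0| <= dlt) ->
    h (x + \sum_(i <- s) u i 0 *: delta_mx i 0) <= h x + e.
Proof.
move=> ch e0; elim: s => [|i s [d1 d10 hd1]].
  by exists 1 => // u _; rewrite big_nil addr0 lerDl ltW.
(* [M] exceeds the growth of [h] over a unit step along the axis in either direction. *)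
pose M := `|h (x + delta_mx i 0) - h x| + `|h (x - delta_mx i 0) - h x| + 1.
have M0 : 0 < M by rewrite ltr_wpDl ?addr_ge0.
exists (Num.min (d1 / 2) (Num.min 2^-1 (e / M / 2))).
  by rewrite !lt_min !divr_gt0// invr_gt0 ltr0n.
move=> u hu.
have uj j : [/\ 2 * `|u j 0| <= d1, 2 * `|u j 0| <= 1 & 2 * `|u j 0| * M <= e].
  have := hu j; rewrite !le_min => /and3P[? ? ?]; split; [lra|lra|].
  by rewrite -ler_pdivlMr//; lra.
have h1 : h (x + \sum_(j <- s) (2 *: u) j 0 *: delta_mx j 0) <= h x + e.
  by apply: hd1 => j; rewrite mxE normrM ger0_norm//; have [] := uj j.
have h2 : h (x + (2 * u i 0) *: delta_mx i 0) <= h x + e.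
  have [_ u1 uM] := uj i.
  have [ui0|ui0] := leP 0 (u i 0).
    rewrite ger0_norm// in u1 uM.
    have := convex_line x (delta_mx i 0) ch (mulr_ge0 (ler0n R 2) ui0) u1.
    move=> /le_trans; apply; rewrite lerD2l (le_trans _ uM)//.
    rewrite ler_wpM2l ?mulr_ge0// (le_trans (ler_norm _))// /M.
    by have := normr_ge0 (h (x - delta_mx i 0) - h x); lra.
  rewrite ltr0_norm// in u1 uM.
  have nui0 : 0 <= 2 * - u i 0 by lra.
  have := convex_line x (- delta_mx i 0) ch nui0 u1.
  rewrite mulrN scalerN scaleNr opprK.
  move=> /le_trans; apply; rewrite lerD2l (le_trans _ uM)// -mulrN.
  rewrite ler_wpM2l// (le_trans (ler_norm _))// /M.
  by have := normr_ge0 (h (x + delta_mx i 0) - h x); lra.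
have /convexP ch' := ch.
have ch2 := ch' 2^-1 (x + (2 * u i 0) *: delta_mx i 0)
           (x + \sum_(j <- s) (2 *: u) j 0 *: delta_mx j 0).
have -> : x + \sum_(j <- i :: s) u j 0 *: delta_mx j 0 =
    2^-1 *: (x + (2 * u i 0) *: delta_mx i 0) +
    (1 - 2^-1) *: (x + \sum_(j <- s) (2 *: u) j 0 *: delta_mx j 0).
  have -> : 1 - 2^-1 = 2^-1 :> R by lra.
  rewrite big_cons -scalerDr addrACA scalerDr -mulr2n -[x *+ 2]scaler_nat.
  rewrite scalerA mulVf// scale1r; congr (_ + _); rewrite scalerDr scalerA.
  rewrite mulrA mulVf// mul1r; congr (_ + _); rewrite scaler_sumr.
  by apply: eq_bigr => j _; rewrite mxE scalerA mulrA mulVf// mul1r.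
by apply: le_trans; [apply: ch2; lra|lra].
Qed.

Lemma col_sum_delta (u : 'cV[R]_n) : u = \sum_i u i 0 *: delta_mx i 0.
Proof.
apply/matrixP => i j; rewrite ord1 summxE (bigD1 i)//= big1 => [|k ki].
  by rewrite !mxE !eqxx mulr1 addr0.
by rewrite !mxE eq_sym (negbTE ki) mulr0.
Qed.

(** The upper bound near x yields the lower one by reflection, since h x is at most the average of h
    (x + u) and h (x - u). *)
Lemma convex_continuous h x (e : R) : convex h -> 0 < e ->
  exists2 dlt, 0 < dlt & forall u : 'cV[R]_n, (forall i, `|u i 0| <= dlt) ->
    `|h (x + u) - h x| <= e.
Proof.
move=> ch e0; have [dl dl0 hdl] := convex_near_le x (index_enum 'I_n) ch e0.
exists dl => // u hu; have hp := hdl u hu; rewrite -col_sum_delta in hp.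
have hm : h (x - u) <= h x + e.
  by rewrite [- u]col_sum_delta; apply: hdl => i; rewrite mxE normrN.
 rewrite ler_norml; apply/andP; split; last by lra.
have /convexP/(_ 2^-1 (x + u) (x - u)) := ch.
have -> : 1 - 2^-1 = 2^-1 :> R by lra.
rewrite -scalerDr addrACA subrr addr0 -mulr2n -[x *+ 2]scaler_nat scalerA.
rewrite mulVf// scale1r => hx.
have : h x <= 2^-1 * h (x + u) + 2^-1 * h (x - u) by apply: hx; lra.
lra.
Qed.

End convexity.

(** * Existence and optimality of proximal points *)

Section proximal_point.
Context {R : realType} {n : nat}.
Implicit Types (h : 'cV[R]_n -> R) (x y z c xi : 'cV[R]_n).

Lemma convex_add_sqr h c (s : R) : 0 <= s -> convex h ->
  convex (fun y => h y + s * dotc (y - c) (y - c)).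
Proof.
move=> s0 /convexP ch; apply/convexP => t x y t0 t1.
have := ch t x y t0 t1.
have -> : t *: x + (1 - t) *: y - c = t *: (x - c) + (1 - t) *: (y - c).
  rewrite !scalerBr addrACA -opprD -scalerDl [t + _]addrC subrK scale1r.
  by [].
have := mulr_ge0 (mulr_ge0 s0 (mulr_ge0 t0 (_ : 0 <= 1 - t)))
  (dotc_ge0 ((x - c) - (y - c))).
rewrite subr_ge0 => /(_ t1).
move: (x - c) (y - c) => a b; rewrite !dotc_lin (dotcC b a); lra.
Qed.

(** The subgradient gives an affine minorant that the quadratic term dominates far from [c], so a
    minimum over a large box around [c] is global. *)
Lemma prox_point_exists h xi y0 c (s : R) :
  convex h -> subdifferential h y0 xi -> 0 < s ->
  exists z, forall y, h z + s / 2 * dotc (z - c) (z - c) <=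
                      h y + s / 2 * dotc (y - c) (y - c).
Proof.
move=> ch hxi s0; pose F y := h y + s / 2 * dotc (y - c) (y - c).
have cF : convex F by apply: convex_add_sqr => //; lra.
(* Half of the quadratic term absorbs the linear one by Young's inequality with constant s / 4; [B]
   is the squared distance beyond which the other half lifts [F] above [F c], that is above
   [h c]. *)
pose B := 4 / s * (h c - (h y0 + dotc xi (c - y0) - dotc xi xi / s)).
have hB y : B <= dotc (y - c) (y - c) -> h c <= F y.
  have -> : dotc (y - c) (y - c) = 4 / s * (s / 4 * dotc (y - c) (y - c)).
    by rewrite mulrA; field; rewrite gt_eqF.
  rewrite ler_pM2l ?divr_gt0// /F => By.
  have := hxi y; have -> : y - y0 = (y - c) + (c - y0) by rewrite addrA subrK.
  rewrite dotcDr.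
  have s4 : 0 < s / 4 by lra.
  move: (y - c) By => v By; have := dotc_young (- xi) v s4; rewrite !dotcNl dotcNr.
  have -> : (4 * (s / 4))^-1 = s^-1 by congr (_^-1); lra.
  by move: By; lra.
(* A point outside the box of half-width [D] has squared distance at least D * D >= B. The box
   consists of row vectors, the setting of [rV_compact] and [EVT_min_rV]. *)
pose D := `|B| + 1.
pose A : set 'rV[R]_n := [set v : 'rV[R]_n |
  forall i, `[c i 0 - D, c i 0 + D]%classic (v ord0 i)].
have D0 : 0 < D by rewrite /D ltr_wpDl.
have cA : compact A.
  apply: (@rV_compact _ _ (fun i => `[c i 0 - D, c i 0 + D]%classic)) => i.
  exact: segment_compact.
have cAc : A c^T.
  by move=> i /=; rewrite mxE in_itv/=; apply/andP; split; lra.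
have ctF : continuous (fun v : 'rV[R]_n => F v^T).
  move=> v; apply/(@cvgrPdist_le _ _ _ (nbhs v)) => e e0.
  have [dl dl0 hdl] := convex_continuous v^T cF e0.
  apply/nbhs_ballP; exists dl => //= w [_ vw].
  rewrite distrC; have -> : w^T = v^T + (w^T - v^T) by rewrite addrC subrK.
  apply: hdl => i.
  by rewrite !mxE distrC ltW//; exact: (vw ord0 i).
have [z _ zmin] := EVT_min_rV (ex_intro _ _ cAc) cA (continuous_subspaceT ctF).
exists z^T => y; have [yA|yA] := pselect (A y^T).
  by have := zmin y^T; rewrite trmxK; apply; rewrite inE.
have zc : F z^T <= h c.
  have := zmin c^T; rewrite inE trmxK => /(_ cAc).
  by rewrite {2}/F subrr dotc0l mulr0 addr0.
apply: (le_trans zc); apply: hB.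
have [i yi] : exists i, D < `|(y - c) i 0|.
  apply: contra_notP yA => /forallNP yA i /=.
  have /negP := yA i; rewrite -leNgt !mxE ler_norml in_itv/= => /andP[? ?].
  by apply/andP; split; lra.
have := dotc_le_entry (y - c) i; apply: le_trans.
rewrite -[_ ^+ 2]ger0_norm ?sqr_ge0// normrX expr2.
have := ler_norm B; have : `|B| * 1 <= D * D.
  by apply: ler_pM => //; rewrite /D ?lerDl ?lerDr.
have : D * D <= `|(y - c) i 0| * `|(y - c) i 0|.
  by apply: ler_pM; rewrite ?ltW.
by lra.
Qed.

(** Fermat's rule: compare z with z + t (y - z), divide by t and let t tend to 0; the quadratic
    remainder is of order t. *)
Lemma prox_point_subdifferential h c z (s : R) : convex h ->
  (forall y, h z + s / 2 * dotc (z - c) (z - c) <=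
             h y + s / 2 * dotc (y - c) (y - c)) ->
  subdifferential h z (s *: (c - z)).
Proof.
move=> ch hz y; rewrite -subr_ge0.
apply: (@ge0_add_small _ _ (s / 2 * dotc (y - z) (y - z))) => t t0 t1.
have := convex_line z (y - z) ch (ltW t0) t1.
have -> : z + (y - z) = y by rewrite addrC subrK.
have := hz (z + t *: (y - z)).
have -> : z + t *: (y - z) - c = t *: (y - z) - (c - z).
  by rewrite opprB addrAC addrC.
have -> : dotc (z - c) (z - c) = dotc (c - z) (c - z).
  by rewrite -(opprB c z) dotcNl dotcNr opprK.
move: (y - z) (c - z) => u v; rewrite !dotc_lin (dotcC v u) => h1 h2.
rewrite -(@pmulr_rge0 _ t)//; lra.
Qed.

End proximal_point.

(** * Smooth convex functions *)

Section smooth_convex.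
Context {R : realType} {n : nat}.
Implicit Types (f : 'cV[R]_n -> R) (x y z v xi : 'cV[R]_n).

Lemma derive_gradient f x v : differentiable f x ->
  'D_v f x = dotc (gradient f x) v.
Proof.
move=> df; rewrite deriveE// {1}[v]col_sum_delta linear_sum dotcE.
by apply: eq_bigr => i _; rewrite linearZ mxE deriveE// mulrC.
Qed.

Lemma derive_at_right f x v : differentiable f x ->
  (fun t : R => t^-1 * (f (x + t *: v) - f x)) @ 0^'+ --> 'D_v f x.
Proof.
move=> df; apply: cvg_dnbhs_at_right.
have /cvg_ex[l hl] : derivable f x v by exact: diff_derivable.
rewrite /derive (cvg_lim _ hl)//.
rewrite (_ : (fun t => _) = (fun t => t^-1 *: ((f \o shift x) (t *: v) - f x)))//.
by apply/funext => t /=; rewrite [t *: v + x]addrC.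
Qed.

Lemma gradient_subdifferential f x : convex f -> differentiable f x ->
  subdifferential f x (gradient f x).
Proof.
move=> cf df y; rewrite -lerBrDl -derive_gradient//.
apply: (cvgr_to_le (@derive_at_right f x (y - x) df)).
near=> t.
have t0 : 0 < t by near: t; exact: nbhs_right_gt.
have t1 : t <= 1 by near: t; exact: nbhs_right_le.
have := convex_line x (y - x) cf (ltW t0) t1.
rewrite [x + (y - x)]addrC subrK ler_pdivrMl//.
by lra.
Unshelve. all: by end_near. Qed.

(** Along the direction xi - gradient f x, the subgradient inequality gives |xi - gradient f x|^2 <=
    0 in the limit. *)
Lemma subdifferential_gradient f x xi : differentiable f x ->
  subdifferential f x xi -> xi = gradient f x.
Proof.
move=> df hxi; apply/eqP; rewrite -subr_eq0; apply/eqP/dotc_eq0/le_anti.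
rewrite dotc_ge0 andbT {1}dotcDl dotcNl subr_le0 -derive_gradient//.
apply: (cvgr_to_ge (@derive_at_right f x _ df)).
near=> t.
have t0 : 0 < t by near: t; exact: nbhs_right_gt.
have := hxi (x + t *: (xi - gradient f x)).
rewrite [x + _ - x]addrAC subrr add0r dotcZr ler_pdivlMl//.
by lra.
Unshelve. all: by end_near. Qed.

(** No integral along the segment is taken. Convexity at x + v with the Lipschitz bound gives the
    constant L in place of L / 2, and repeated bisection of the segment removes the excess. *)
Lemma smooth_descent f (L : R) x v : convex f -> smooth L f ->
  f (x + v) <= f x + dotc (gradient f x) v + L / 2 * dotc v v.
Proof.
move=> cf [df lf].
have bound u w : dotc (gradient f (u + w) - gradient f u) w <= L * dotc w w.
  rewrite (le_trans (dotc_le_norm2 _ _))// -norm2_sqr expr2 mulrA.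
  rewrite ler_wpM2r ?norm2_ge0//; have := lf (u + w) u.
  by rewrite [u + w - u]addrAC subrr add0r.
(* Halving the step improves the constant C to C / 2 + L / 4, whose fixed
   point is L / 2. *)
have iter k u w : f (u + w) <=
    f u + dotc (gradient f u) w + (L / 2 + L / 2 / 2 ^+ k) * dotc w w.
  elim: k u w => [|k IH] u w.
    have := gradient_subdifferential cf (df (u + w)) u.
    rewrite opprD addrA subrr add0r dotcNr.
    have := bound u w; rewrite dotcDl dotcNl expr0 divr1; lra.
  have := IH (u + 2^-1 *: w) (2^-1 *: w); have := IH u (2^-1 *: w).
  have := bound u (2^-1 *: w).
  have -> : u + 2^-1 *: w + 2^-1 *: w = u + w.
    rewrite -addrA -scalerDl (_ : 2^-1 + 2^-1 = 1 :> R) ?scale1r//; lra.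
  rewrite exprSr invfM !dotcZl !dotcZr dotcDl dotcNl !mulrA.
  have -> : L / 2 / 2 ^+ k / 2 = L / 2 / 2 ^+ k * 2^-1 by [].
  move: (L / 2 / 2 ^+ k) => q; lra.
rewrite -subr_ge0; apply: (@ge0_add_half_pow _ _ (L / 2 * dotc v v)) => k.
have := iter k x v.
have -> : L / 2 * dotc v v / 2 ^+ k = L / 2 / 2 ^+ k * dotc v v.
  by rewrite mulrAC.
lra.
Qed.

(* Baillon-Haddad: the descent inequality is applied at the gradient step from
   y, where the tangent of f at x is still a lower bound. *)
Lemma smooth_cocoercive f (gam : R) x y : 0 < gam ->
  convex f -> smooth (1 / gam) f ->
  gam * dotc (gradient f x - gradient f y) (gradient f x - gradient f y) <=
    dotc (gradient f x - gradient f y) (x - y).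
Proof.
move=> g0 cf sf.
have half u w : f u + dotc (gradient f u) (w - u) + gam / 2 *
    dotc (gradient f w - gradient f u) (gradient f w - gradient f u) <= f w.
  pose D := gradient f w - gradient f u.
  have := gradient_subdifferential cf (sf.1 u) (w + (- gam) *: D).
  have := smooth_descent w ((- gam) *: D) cf sf.
  have -> : w + (- gam) *: D - u = (w - u) + (- gam) *: D by rewrite addrAC.
  rewrite -/D dotcDr !dotcZr dotcZl.
  have -> : gradient f w = D + gradient f u by rewrite subrK.
  have -> : 1 / gam / 2 * (- gam * (- gam * dotc D D)) = gam / 2 * dotc D D.
    by field; rewrite gt_eqF.
  rewrite dotcDl; lra.
have := half x y; have := half y x.
have -> : gradient f y - gradient f x = - (gradient f x - gradient f y).
  by rewrite opprB.
have -> : y - x = - (x - y) by rewrite opprB.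
move: (x - y) => u; rewrite [in X in _ -> _ -> _ <= X]dotcDl dotcNl.
move: (gradient f x - gradient f y) => D; rewrite !dotcNl !dotcNr; lra.
Qed.

End smooth_convex.

(** * Conjugates and proximal maps *)

Section conjugate_prox.
Context {R : realType} {n : nat}.
Implicit Types (f g : 'cV[R]_n -> R) (a u v x y z xi : 'cV[R]_n).

Lemma conjugate_ge f a u : ((dotc a u - f u)%:E <= conjugate f a)%E.
Proof. by apply: ereal_sup_ubound; exists u. Qed.

Lemma conjugate_neqNy f a : conjugate f a != -oo%E.
Proof. by apply/eqP => h; have := conjugate_ge f a 0; rewrite h. Qed.

Lemma conjugate_subdifferential f a z : subdifferential f z a ->
  conjugate f a = (dotc a z - f z)%:E.
Proof.
move=> haz; apply/eqP; rewrite eq_le conjugate_ge andbT.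
apply: ge_ereal_sup => _ [u _ <-]; rewrite lee_fin.
by have := haz u; rewrite dotcDr dotcNr; lra.
Qed.

(* Moreau: the minimiser z of f + s/2 |. - v/s|^2 yields the proximal point
   v - s z of s f^*, which is the gradient of f at z. *)
Lemma prox_conjugate f (s : R) v : convex f -> (forall x, differentiable f x) ->
  0 < s ->
  let a := prox (fun y => s%:E * conjugate f y)%E v in
  a = gradient f (s^-1 *: (v - a)).
Proof.
move=> cf df s0 /=.
have [z zmin] := prox_point_exists (s^-1 *: v) cf
  (gradient_subdifferential cf (df 0)) s0.
have hz := prox_point_subdifferential cf zmin.
have sz : s *: (s^-1 *: v - z) = v - s *: z.
  by rewrite scalerBr scalerA mulfV ?gt_eqF// scale1r.
rewrite sz in hz; have az := subdifferential_gradient (df z) hz.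
suff -> : prox (fun y => s%:E * conjugate f y)%E v = v - s *: z.
  by rewrite opprB [v + (_ - _)]addrC subrK scalerA mulVf ?gt_eqF// scale1r.
set a := v - s *: z in hz az *.
(* The conjugate is replaced by its affine minorant at [z], which is exact at [a]. The remaining
   quadratic in [u - a] gives minimality and uniqueness at once, even where the conjugate is +oo. *)
have key u : ((s * (dotc a z - f z) + 2^-1 * norm2 (a - v) ^+ 2 +
              2^-1 * dotc (u - a) (u - a))%:E <=
    s%:E * conjugate f u + (2^-1 * norm2 (u - v) ^+ 2)%:E)%E.
  apply: (@le_trans _ _ ((s * (dotc u z - f z) + 2^-1 * norm2 (u - v) ^+ 2)%:E)).
    rewrite lee_fin !norm2_sqr; have -> : u - v = (u - a) - s *: z.
      by rewrite /a opprB addrA addrAC addrK.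
    have -> : a - v = - (s *: z) by rewrite /a addrAC subrr add0r.
    have {3}-> : u = (u - a) + a by rewrite subrK.
    move: (u - a) => b; rewrite !dotc_lin (dotcC z b); lra.
  rewrite EFinD leeD2r// EFinM lee_wpmul2l ?lee_fin ?(ltW s0)//.
  exact: conjugate_ge.
have val : (s%:E * conjugate f a + (2^-1 * norm2 (a - v) ^+ 2)%:E)%E =
    (s * (dotc a z - f z) + 2^-1 * norm2 (a - v) ^+ 2)%:E.
  by rewrite (conjugate_subdifferential hz) -EFinM -EFinD.
rewrite /prox; apply: xget_unique => [u /=|u /(_ a) /=]; rewrite val.
  apply: le_trans (key u); rewrite lee_fin lerDl.
  by rewrite mulr_ge0 ?invr_ge0 ?dotc_ge0.
move/(le_trans (key u)); rewrite lee_fin => h.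
apply/eqP; rewrite -subr_eq0; apply/eqP/dotc_eq0/le_anti.
by rewrite dotc_ge0 andbT; lra.
Qed.

(** Dividing the objective by [s] turns it into [g] plus a quadratic of modulus 1 / s; the
    subgradient at [y0] guarantees that the minimum is attained, so that [xget] returns a
    minimiser. *)
Lemma prox_subdifferential g (s : R) v y0 xi : convex g ->
  subdifferential g y0 xi -> 0 < s ->
  let y := prox (fun y => (s * g y)%:E) v in
  subdifferential g y (s^-1 *: (v - y)).
Proof.
move=> cg hxi s0 /=.
have si0 : 0 < s^-1 by rewrite invr_gt0.
apply: prox_point_subdifferential => // u.
pose phi y := ((s * g y)%:E + (2^-1 * norm2 (y - v) ^+ 2)%:E)%E.
have [z zmin] := prox_point_exists v cg hxi si0.
have scl y : s * g y + 2^-1 * norm2 (y - v) ^+ 2 =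
    s * (g y + s^-1 / 2 * dotc (y - v) (y - v)).
  by rewrite norm2_sqr; field; rewrite gt_eqF.
have hz : argmin phi z.
  by move=> y; rewrite /phi -!EFinD lee_fin !scl ler_pM2l.
have := xgetI 0 hz u; rewrite /phi -!EFinD lee_fin !scl ler_pM2l//.
Qed.

End conjugate_prox.

(** * The saddle point *)

Section saddle.
Context {R : realType} {m n : nat} {N : 'I_m -> nat} {d : 'I_n -> nat}.
Variables (X : 'M[R]_(\sum_i N i, \sum_k d k)).
Variables (f : forall i, 'cV[R]_(N i) -> R) (g : forall k, 'cV[R]_(d k) -> R).
Variables (wstar : 'cV[R]_(\sum_k d k)) (astar : 'cV[R]_(\sum_i N i)).
Arguments f : clear implicits.
Arguments g : clear implicits.
Hypothesis m_gt0 : (0 < m)%N.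
Hypothesis convex_f : forall i, convex (f i).
Hypothesis diff_f : forall i x, differentiable (f i) x.
Hypothesis saddle_star : saddle_point (lagrangian X f g) wstar astar.

Let Z i := submxcol X i *m wstar.

Lemma lagrangian_finite w a (c : 'I_m -> R) :
  (forall i, conjugate (f i) (submxcol a i) = (c i)%:E) ->
  lagrangian X f g w a =
    (m%:R^-1 * (\sum_i dotc (submxcol a i) (submxcol X i *m w) - \sum_i c i)
     + separable g w)%:E.
Proof.
move=> hc; rewrite /lagrangian (eq_bigr (fun i => (c i)%:E))//.
by rewrite sumEFin -EFinM -EFinB -EFinD mulrBr.
Qed.

(** Compare [astar] with the gradients [b], for which Fenchel-Young is an equality. The saddle
    inequality makes the sum of the Fenchel-Young gaps of [astar] nonpositive; each gap is
    nonnegative, so all vanish, and [astar] consists of subgradients. *)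
Lemma saddle_conjugate i : submxcol astar i = gradient (f i) (Z i) /\
  exists c, conjugate (f i) (submxcol astar i) = c%:E.
Proof.
pose b := \mxcol_i gradient (f i) (Z i) : 'cV[R]_(\sum_i N i).
have hb j : conjugate (f j) (submxcol b j) =
    (dotc (submxcol b j) (Z j) - f j (Z j))%:E.
  apply: conjugate_subdifferential; rewrite mxcolK.
  exact: gradient_subdifferential.
have m0 : (0 : R) < m%:R^-1 by rewrite invr_gt0 ltr0n.
have /andP[+ _] := saddle_star wstar b.
rewrite (lagrangian_finite _ hb) => hL.
have fin j : exists c, conjugate (f j) (submxcol astar j) = c%:E.
  case hcj : (conjugate (f j) (submxcol astar j)) => [c| |]; first by exists c.
    (* One infinite conjugate would send the Lagrangian at [astar] to -oo, below its finite value at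
       [b]. *)
    suff S : (\sum_i conjugate (f i) (submxcol astar i) = +oo)%E.
      by move: hL; rewrite /lagrangian S gt0_muley ?lte_fin// addeNy.
    apply/eqP; rewrite esum_eqy => [|k _]; last exact: conjugate_neqNy.
    by apply/existsP; exists j; rewrite hcj.
  by have := conjugate_neqNy (f j) (submxcol astar j); rewrite hcj.
split; last exact: fin.
have [c hc] : exists c, forall j, conjugate (f j) (submxcol astar j) = (c j)%:E.
  exists (fun j => fine (conjugate (f j) (submxcol astar j))) => j.
  by have [r ->] := fin j.
pose gap j := c j - (dotc (submxcol astar j) (Z j) - f j (Z j)).
have gap0 j : 0 <= gap j.
  by rewrite subr_ge0 -lee_fin -hc; exact: conjugate_ge.
have sgap : \sum_j gap j <= 0.
  move: hL; rewrite (lagrangian_finite _ hc) lee_fin lerD2r ler_pM2l//.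
  by rewrite /gap !sumrB; lra.
have gi : gap i = 0.
  apply: (@psumr_eq0P _ _ xpredT gap (fun j _ => gap0 j)) => //.
  by apply/le_anti; rewrite sgap sumr_ge0.
apply: subdifferential_gradient => // u.
have := conjugate_ge (f i) (submxcol astar i) u; rewrite hc lee_fin.
by move: gi; rewrite /gap dotcDr dotcNr; lra.
Qed.

(** With the dual variable fixed at [astar], the conjugates are finite and cancel; what remains of
    the saddle inequality is linear in [w] plus [separable g]. *)
Lemma saddle_primal :
  subdifferential (separable g) wstar (- (m%:R^-1 *: (X^T *m astar))).
Proof.
move=> w; have /andP[_] := saddle_star w astar.
have [c hc] : exists c, forall j, conjugate (f j) (submxcol astar j) = (c j)%:E.
  exists (fun j => fine (conjugate (f j) (submxcol astar j))) => j.
  by have [_ [r ->]] := saddle_conjugate j.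
rewrite !(lagrangian_finite _ hc) lee_fin.
have sumE v : \sum_i dotc (submxcol astar i) (submxcol X i *m v) =
    dotc (X^T *m astar) v.
  rewrite -dotc_mulmx dotc_blocks; apply: eq_bigr => i _.
  by rewrite submxcol_mul.
by rewrite !sumE !dotcNl !dotcZl dotcDr dotcNr; lra.
Qed.

End saddle.

(** * Restriction of a separable function to one block *)

Section separable.
Context {R : realType} {n : nat} {d : 'I_n -> nat}.
Variables (g : forall k, 'cV[R]_(d k) -> R).
Arguments g : clear implicits.

Lemma separable_set_block w k (y : 'cV[R]_(d k)) :
  separable g (set_block w y) =
  g k y + \sum_(j | j != k) g j (submxcol w j).
Proof.
rewrite /separable (bigD1 k)//= submxcol_set_block dfwithin; congr (_ + _).
by apply: eq_bigr => j jk; rewrite submxcol_set_block dfwithout// eq_sym.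
Qed.

Lemma set_block_id (w : 'cV[R]_(\sum_k d k)) k : set_block w (submxcol w k) = w.
Proof.
apply/mxcolP => j; rewrite submxcol_set_block.
have [->|jk] := eqVneq j k; first by rewrite dfwithin.
by rewrite dfwithout// eq_sym.
Qed.

Lemma dotc_set_block (w v : 'cV[R]_(\sum_k d k)) k x y :
  dotc (set_block v x) (set_block w y - w) = dotc x (y - submxcol w k).
Proof.
rewrite dotc_blocks (bigD1 k)//= [X in _ + X]big1 => [|j jk].
  by rewrite submxcolB !submxcol_set_block !dfwithin addr0.
by rewrite submxcolB !submxcol_set_block !dfwithout 1?eq_sym// subrr dotc0r.
Qed.

Lemma subdifferential_block w xi k : subdifferential (separable g) w xi ->
  subdifferential (g k) (submxcol w k) (submxcol xi k).
Proof.
move=> hw y; have := hw (set_block w y).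
rewrite -{1}(set_block_id xi k) dotc_set_block -{1}(set_block_id w k).
by rewrite !separable_set_block; lra.
Qed.

(** Strong convexity speaks only of subgradients of the whole sum. A subgradient [z] of one block is
    completed by the blocks of the known subgradient [xi] at [w], the other blocks of the point
    staying at [w]. *)
Lemma strongly_convex_block (lambda : R) w xi k :
  strongly_convex lambda (separable g) -> subdifferential (separable g) w xi ->
  convex (g k) /\ forall y y' z, subdifferential (g k) y z ->
    g k y + dotc z (y' - y) + lambda / 2 * dotc (y' - y) (y' - y) <= g k y'.
Proof.
move=> [cg sg] hw; split.
  apply/convexP => t x y t0 t1; have /convexP := cg.
  move=> /(_ t (set_block w x) (set_block w y) t0 t1).
  have -> : t *: set_block w x + (1 - t) *: set_block w y =
      set_block w (t *: x + (1 - t) *: y).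
    apply/mxcolP => j; rewrite submxcolD.
    have Z a v : submxcol (a *: v) j = a *: submxcol v j :> 'cV[R]_(d j).
      by apply/matrixP => ? ?; rewrite !mxE.
    rewrite !Z !submxcol_set_block.
    have [->|jk] := eqVneq j k; first by rewrite !dfwithin.
    by rewrite !dfwithout 1?eq_sym// -scalerDl addrC subrK scale1r.
  rewrite !separable_set_block; lra.
move=> y y' z hz.
have diff : set_block w y' - set_block w y =
    set_block (set_block w y) y' - set_block w y.
  congr (_ - _); apply/mxcolP => j; rewrite !submxcol_set_block.
  have [->|jk] := eqVneq j k; first by rewrite !dfwithin.
  by rewrite !dfwithout 1?eq_sym// submxcol_set_block dfwithout// eq_sym.
have := sg (set_block w y) (set_block w y') (set_block xi z).
rewrite norm2_sqr.
have -> : dotc (set_block w y' - set_block w y) (set_block w y' - set_block w y)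
    = dotc (y' - y) (y' - y).
  rewrite dotc_blocks (bigD1 k)//= [X in _ + X]big1 => [|j jk].
    by rewrite submxcolB !submxcol_set_block !dfwithin addr0.
  by rewrite submxcolB !submxcol_set_block !dfwithout 1?eq_sym// subrr dotc0r.
rewrite diff dotc_set_block submxcol_set_block dfwithin !separable_set_block.
move=> h.
suff /h : subdifferential (separable g) (set_block w y) (set_block xi z) by lra.
move=> v; rewrite dotc_blocks /separable -big_split/= ler_sum// => j _.
rewrite submxcolB !submxcol_set_block.
have [->|jk] := eqVneq j k; first by rewrite !dfwithin; exact: hz.
by rewrite !dfwithout 1?eq_sym//; exact: subdifferential_block.
Qed.

End separable.

(** * One block step *)

Section block_steps.
Context {R : realType} {n : nat}.
Implicit Types (f g : 'cV[R]_n -> R) (a u v w x y z : 'cV[R]_n).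

(** With A = a' - a, B = a - a0 and U = u - z0, cocoercivity reads gam |A + B|^2 <= (U - 2 c A) . (A
    + B). The part in c equals c |B|^2 - c |A|^2 - c |A + B|^2, and the surplus - c |A|^2 pays for U
    . A by Young. *)
Lemma dual_block_step f (gam c s : R) z0 a0 a a' u :
  convex f -> smooth (1 / gam) f -> 0 < gam -> 0 < c ->
  s = (2 * c)^-1 -> a0 = gradient f z0 ->
  a' = prox (fun y => s%:E * conjugate f y)%E (a + s *: u) ->
  (c + gam) * dotc (a' - a0) (a' - a0) <=
  c * dotc (a - a0) (a - a0) + dotc (u - z0) (a - a0) +
  (4 * c)^-1 * dotc (u - z0) (u - z0).
Proof.
move=> cf sf g0 c0 sE a0E a'E.
have s0 : 0 < s by rewrite sE invr_gt0 mulr_gt0.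
pose z := (2 * c) *: (a - a') + u.
have az : a' = gradient f z.
  (* As 1 / s = 2 c, the point given by [prox_conjugate] is [z]. *)
  rewrite {1}a'E (prox_conjugate (a + s *: u) cf sf.1 s0) -a'E; congr gradient.
  rewrite /z sE invrK addrAC scalerDr scalerA mulfV ?scale1r//.
  by rewrite mulf_neq0// gt_eqF.
have := smooth_cocoercive z z0 g0 cf sf; rewrite -az -a0E /z.
have := dotc_young (u - z0) (a' - a) c0.
have -> : a - a' = - (a' - a) by rewrite opprB.
have -> : a' - a0 = (a' - a) + (a - a0) by rewrite addrA subrK.
rewrite -[_ + u - z0]addrA.
move: (u - z0) (a' - a) (a - a0) => U A B.
rewrite !dotc_lin (dotcC B A) (dotcC A U) (dotcC B U); lra.
Qed.

(** The dual argument with strong monotonicity in place of cocoercivity: the strong convexity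
    inequalities from w' to w0 and from w0 to w' are added, which cancels the values of [g]. *)
Lemma primal_block_step g (lam c s : R) w0 v0 w w' v : convex g ->
  (forall y y' xi, subdifferential g y xi ->
    g y + dotc xi (y' - y) + lam / 2 * dotc (y' - y) (y' - y) <= g y') ->
  subdifferential g w0 (- v0) -> 0 < c ->
  s = (2 * c)^-1 ->
  w' = prox (fun y => (s * g y)%:E) (w - s *: v) ->
  (c + lam) * dotc (w' - w0) (w' - w0) <=
  c * dotc (w - w0) (w - w0) - dotc (v - v0) (w - w0) +
  (4 * c)^-1 * dotc (v - v0) (v - v0).
Proof.
move=> cg sg hw0 c0 sE w'E.
have s0 : 0 < s by rewrite sE invr_gt0 mulr_gt0.
have /= := prox_subdifferential (w - s *: v) cg hw0 s0; rewrite -w'E.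
have -> : s^-1 *: (w - s *: v - w') = (2 * c) *: (w - w') - v.
  rewrite sE invrK addrAC scalerBr scalerA mulfV ?scale1r//.
  by rewrite mulf_neq0// gt_eqF.
move=> hw'; have := sg _ w0 _ hw'; have := sg _ w' _ hw0.
have := dotc_young (- (v - v0)) (w' - w) c0.
have -> : w0 - w' = - (w' - w0) by rewrite opprB.
have -> : w - w' = - (w' - w) by rewrite opprB.
have -> : w' - w0 = (w' - w) + (w - w0) by rewrite addrA subrK.
have -> : v = (v - v0) + v0 by rewrite subrK.
have -> : v - v0 + v0 - v0 = v - v0 by rewrite addrK.
move: (v - v0) (w' - w) (w - w0) => V A B.
rewrite !dotc_lin ?(dotcC B A) ?(dotcC A V) ?(dotcC B V).
rewrite ?(dotcC A v0) ?(dotcC B v0); lra.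
Qed.

End block_steps.

(** * Mean and variance of the SAGA estimator *)

Section saga_estimator.
Context {R : realType} {n d : nat} (q : 'I_n -> R) (A B : 'I_n -> 'cV[R]_d).
Hypothesis q_gt0 : forall k, 0 < q k.
Hypothesis q_sum1 : \sum_k q k = 1.

(** Error of an estimate: [A] holds the errors of the current block products, [B] those of the
    stored ones. *)
Let est l := (q l)^-1 *: A l - ((q l)^-1 *: B l - \sum_k B k).

Lemma saga_estimator_mean : \sum_l q l *: est l = \sum_l A l.
Proof.
transitivity (\sum_l (A l - B l + q l *: \sum_k B k)).
  apply: eq_bigr => l _; rewrite /est opprB addrCA !scalerDr scalerN.
  by rewrite !scalerA mulfV ?gt_eqF// !scale1r addrC.
by rewrite big_split/= -scaler_suml q_sum1 scale1r sumrB subrK.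
Qed.

(** The stored part is centred: B_l / q_l has mean S, so its second moment about S is the raw one
    minus |S|^2, which is dropped. The factors 2 come from splitting the square. *)
Lemma saga_estimator_variance :
  \sum_l q l * dotc (est l) (est l) <=
  2 * \sum_l (q l)^-1 * dotc (A l) (A l) +
  2 * \sum_l (q l)^-1 * dotc (B l) (B l).
Proof.
pose S := \sum_k B k.
have sB : \sum_l q l * dotc ((q l)^-1 *: B l - S) ((q l)^-1 *: B l - S) =
    \sum_l (q l)^-1 * dotc (B l) (B l) - dotc S S.
  transitivity (\sum_l ((q l)^-1 * dotc (B l) (B l) - 2 * dotc (B l) S +
      q l * dotc S S)).
    apply: eq_bigr => l _; rewrite !dotc_lin (dotcC S).
    by field; rewrite gt_eqF.
  rewrite big_split/= sumrB -mulr_suml q_sum1 -mulr_sumr -dotc_suml -/S; ring.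
apply: (@le_trans _ _ (2 * (\sum_l (q l)^-1 * dotc (A l) (A l)) +
    2 * (\sum_l (q l)^-1 * dotc (B l) (B l) - dotc S S))); last first.
  by rewrite mulrBr addrA gerBl mulr_ge0// dotc_ge0.
rewrite -sB !mulr_sumr -big_split/= ler_sum// => l _.
have -> : (q l)^-1 * dotc (A l) (A l) =
    q l * dotc ((q l)^-1 *: A l) ((q l)^-1 *: A l).
  by rewrite dotcZl dotcZr; field; rewrite gt_eqF.
have := dotc_sub_le ((q l)^-1 *: A l) ((q l)^-1 *: B l - S).
rewrite /est -/S => /(ler_wpM2l (ltW (q_gt0 l))); lra.
Qed.

End saga_estimator.

(** * Means over one independent pair of indices *)

Section block_sampling.
Context {R : realType} {m n : nat} (p : 'I_m -> R) (q : 'I_n -> R).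
Hypothesis p_sum1 : \sum_i p i = 1.
Hypothesis q_sum1 : \sum_k q k = 1.

Definition index_mean (F : 'I_m -> 'I_n -> R) :=
  \sum_j \sum_l p j * q l * F j l.

Lemma index_meanD F G :
  index_mean (fun j l => F j l + G j l) = index_mean F + index_mean G.
Proof.
rewrite /index_mean -big_split; apply: eq_bigr => j _.
by rewrite -big_split; apply: eq_bigr => l _; rewrite /= mulrDr.
Qed.

Lemma index_meanZ c F :
  index_mean (fun j l => c * F j l) = c * index_mean F.
Proof.
rewrite /index_mean mulr_sumr; apply: eq_bigr => j _.
by rewrite mulr_sumr; apply: eq_bigr => l _; rewrite mulrCA.
Qed.

Lemma index_mean_sum (I : finType) (F : I -> 'I_m -> 'I_n -> R) :
  index_mean (fun j l => \sum_i F i j l) = \sum_i index_mean (F i).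
Proof.
rewrite /index_mean [RHS]exchange_big; apply: eq_bigr => j _.
rewrite [RHS]exchange_big; apply: eq_bigr => l _.
by rewrite mulr_sumr.
Qed.

Lemma index_mean_row i (F : 'I_n -> R) c :
  index_mean (fun j l => if j == i then F l else c) =
  p i * \sum_l q l * F l + (1 - p i) * c.
Proof.
rewrite /index_mean (bigD1 i)//= eqxx; congr (_ + _).
  by rewrite mulr_sumr; apply: eq_bigr => l _; rewrite mulrA.
rewrite -p_sum1 [\sum_i p i](bigD1 i)//= addrAC subrr add0r mulr_suml.
apply: eq_bigr => j /negPf ->.
by rewrite -mulr_suml -mulr_sumr q_sum1 mulr1.
Qed.

Lemma index_mean_col k (F : 'I_m -> R) c :
  index_mean (fun j l => if l == k then F j else c) =
  q k * \sum_j p j * F j + (1 - q k) * c.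
Proof.
rewrite /index_mean exchange_big (bigD1 k)//= eqxx; congr (_ + _).
  by rewrite mulr_sumr; apply: eq_bigr => j _; rewrite mulrA [q k * _]mulrC.
rewrite -q_sum1 [\sum_k q k](bigD1 k)//= addrAC subrr add0r mulr_suml.
apply: eq_bigr => l /negPf ->.
by rewrite -mulr_suml -mulr_suml p_sum1 mul1r.
Qed.

Lemma index_mean_entry i k (a b : R) :
  index_mean (fun j l => if (j == i) && (l == k) then a else b) =
  p i * q k * a + (1 - p i * q k) * b.
Proof.
have -> : (fun j l => if (j == i) && (l == k) then a else b) =
    (fun j l => if j == i then (if l == k then a else b) else b).
  by apply/funext => j; apply/funext => l; case: eqP.
rewrite index_mean_row (bigD1 k)//= eqxx.
under eq_bigr => l /negPf lk do rewrite lk.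
have -> : \sum_(l | l != k) q l * b = (1 - q k) * b.
  by rewrite -q_sum1 [\sum_k q k](bigD1 k)//= addrAC subrr add0r mulr_suml.
ring.
Qed.

End block_sampling.

(** * Contraction of the Lyapunov function *)

Section saga_contraction.
Context {R : realType} {m n : nat} {N : 'I_m -> nat} {d : 'I_n -> nat}.
Variables (X : 'M[R]_(\sum_i N i, \sum_k d k)).
Variables (f : forall i, 'cV[R]_(N i) -> R) (g : forall k, 'cV[R]_(d k) -> R).
Arguments f : clear implicits.
Arguments g : clear implicits.
Variables (lambda : R) (gamma : 'I_m -> R) (p : 'I_m -> R) (q : 'I_n -> R).
Variables (Gamma : R) (sigma : 'I_m -> R) (tau : 'I_n -> R).
Variables (wstar : 'cV[R]_(\sum_k d k)) (astar : 'cV[R]_(\sum_i N i)).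

Local Notation Xb := (submxblock X).
Local Notation state := (saga_state R N d).
Local Notation step := (saga_step X f g p q sigma tau).
Local Notation Emean := (index_mean p q).

Let vstar k : 'cV[R]_(d k) :=
  \sum_i m%:R^-1 *: ((Xb i k)^T *m submxcol astar i).
(** Chosen so that sigma_i = 1 / (2 c_i) and c_i + gamma_i = gamma_i p_i Gamma; likewise [c'] with
    lambda and q_k. *)
Let c i := gamma i * (p i * Gamma - 1).
Let c' k := lambda * (q k * Gamma - 1).

Hypothesis m_gt0 : (0 < m)%N.
Hypothesis n_gt0 : (0 < n)%N.
Hypothesis lambda_gt0 : 0 < lambda.
Hypothesis gamma_gt0 : forall i, 0 < gamma i.
Hypothesis p_gt0 : forall i, 0 < p i.
Hypothesis q_gt0 : forall k, 0 < q k.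
Hypothesis p_sum1 : \sum_i p i = 1.
Hypothesis q_sum1 : \sum_k q k = 1.
Hypothesis Gamma_gt0 : 0 < Gamma.
Hypothesis c_gt0 : forall i, 0 < c i.
Hypothesis c'_gt0 : forall k, 0 < c' k.
Hypothesis sigmaE : forall i, sigma i = (2 * c i)^-1.
Hypothesis tauE : forall k, tau k = (2 * c' k)^-1.
Hypothesis convex_f : forall i, convex (f i).
Hypothesis smooth_f : forall i, smooth (1 / gamma i) (f i).
Hypothesis astarE :
  forall i, submxcol astar i = gradient (f i) (submxcol X i *m wstar).
Hypothesis convex_g : forall k, convex (g k).
Hypothesis strong_g : forall k y y' xi, subdifferential (g k) y xi ->
  g k y + dotc xi (y' - y) + lambda / 2 * dotc (y' - y) (y' - y) <= g k y'.
Hypothesis wstarE :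
  forall k, subdifferential (g k) (submxcol wstar k) (- vstar k).
Hypothesis spectral_dual : forall i k,
  9 * spectral_norm (Xb i k) ^+ 2 <= 2 * lambda * q k * c i.
Hypothesis spectral_primal : forall i k,
  9 * n%:R * spectral_norm (Xb i k) ^+ 2 <= 2 * m%:R * gamma i * p i * c' k.
Hypothesis pq_Gamma : forall i k, (p i * q k)^-1 <= Gamma.

Arguments convex_f : clear implicits.
Arguments convex_g : clear implicits.
Arguments strong_g : clear implicits.
Arguments wstarE : clear implicits.

Definition dual_err (s : state) i := submxcol (sg_alpha s) i - submxcol astar i.
Definition primal_err (s : state) k := submxcol (sg_w s) k - submxcol wstar k.
Definition dual_mem_err (s : state) i k :=
  sg_U s i k - Xb i k *m submxcol wstar k.
Definition primal_mem_err (s : state) i k :=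
  (sg_V s i k)^T - m%:R^-1 *: ((Xb i k)^T *m submxcol astar i).

(** The invariant behind unbiasedness: the running vectors are updated incrementally, yet they
    remain the sums over the tables. *)
Definition table_sums (s : state) :=
  (forall i, submxcol (sg_ubar s) i = \sum_k sg_U s i k) /\
  (forall k, submxcol (sg_vbar s) k = \sum_i (sg_V s i k)^T).

Definition dual_est (s : state) i l :=
  submxcol (sg_ubar s) i - (q l)^-1 *: sg_U s i l
  + (q l)^-1 *: (Xb i l *m submxcol (sg_w s) l).
Definition primal_est (s : state) j k :=
  submxcol (sg_vbar s) k - (p j)^-1 *: (sg_V s j k)^T
  + (p j)^-1 *: (m%:R^-1 *: ((Xb j k)^T *m submxcol (sg_alpha s) j)).

(** Defined for every [i], drawn or not: the updated block then depends on [l] alone, the form that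
    [index_mean_row] averages. *)
Definition dual_new (s : state) i l :=
  prox (fun y => (sigma i)%:E * conjugate (f i) y)%E
    (submxcol (sg_alpha s) i + sigma i *: dual_est s i l).
Definition primal_new (s : state) j k :=
  prox (fun y => (tau k * g k y)%:E)
    (submxcol (sg_w s) k - tau k *: primal_est s j k).

Lemma step_alpha s j l i : submxcol (sg_alpha (step s j l)) i =
  if j == i then dual_new s i l else submxcol (sg_alpha s) i.
Proof.
case: s => w a ub vb U V; rewrite /= submxcol_set_block.
by have [->|ji] := eqVneq j i; rewrite ?dfwithin// dfwithout.
Qed.

Lemma step_w s j l k : submxcol (sg_w (step s j l)) k =
  if l == k then primal_new s j k else submxcol (sg_w s) k.
Proof.
case: s => w a ub vb U V; rewrite /= submxcol_set_block.
by have [->|ji] := eqVneq l k; rewrite ?dfwithin// dfwithout.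
Qed.

Lemma step_U s j l i k : sg_U (step s j l) i k =
  if (j == i) && (l == k) then Xb i k *m submxcol (sg_w s) k else sg_U s i k.
Proof.
case: s => w a ub vb U V /=.
have [<-|ji] := eqVneq j i; last by rewrite dfwithout.
by rewrite dfwithin; have [<-|lk] := eqVneq l k; rewrite ?dfwithin// dfwithout.
Qed.

Lemma step_V s j l i k : (sg_V (step s j l) i k)^T =
  if (j == i) && (l == k) then
    m%:R^-1 *: ((Xb i k)^T *m submxcol (sg_alpha s) i) else (sg_V s i k)^T.
Proof.
case: s => w a ub vb U V /=.
have [<-|ji] := eqVneq j i; last by rewrite dfwithout.
rewrite dfwithin; have [<-|lk] := eqVneq l k; last by rewrite dfwithout.
by rewrite dfwithin trmxK.
Qed.

Lemma table_sums_init w0 a0 : table_sums (saga_init X w0 a0).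
Proof.
split=> [i|k] /=; first by rewrite -submxcol_mul submxcol_mulmx.
have -> : submxcol (m%:R^-1 *: (X^T *m a0)) k =
    m%:R^-1 *: submxcol (X^T *m a0) k.
  by apply/matrixP => ? ?; rewrite !mxE.
rewrite submxcol_trmulmx scaler_sumr; apply: eq_bigr => i _.
by rewrite linearZ/= trmx_mul trmxK.
Qed.

Lemma table_sums_step s j l : table_sums s -> table_sums (step s j l).
Proof.
move=> [hU hV]; split=> [i|k].
- under eq_bigr do rewrite step_U.
  have -> : submxcol (sg_ubar (step s j l)) i = if j == i then
      submxcol (sg_ubar s) i - sg_U s i l + Xb i l *m submxcol (sg_w s) l
      else submxcol (sg_ubar s) i.
    case: {hU hV} s => w a ub vb U V; rewrite /= submxcol_set_block.
    by have [<-|ji] := eqVneq j i; rewrite ?dfwithin// dfwithout.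
  have [ji|//] := eqVneq j i; rewrite /= hU (bigD1 l)//= [in RHS](bigD1 l)//= eqxx.
  rewrite [_ + _ - _]addrAC subrr add0r addrC; congr (_ + _).
  by apply: eq_bigr => k /negPf; rewrite eq_sym => ->.
- under eq_bigr do rewrite step_V.
  have -> : submxcol (sg_vbar (step s j l)) k = if l == k then
      submxcol (sg_vbar s) k - (sg_V s j k)^T
      + m%:R^-1 *: ((Xb j k)^T *m submxcol (sg_alpha s) j)
      else submxcol (sg_vbar s) k.
    case: {hU hV} s => w a ub vb U V; rewrite /= submxcol_set_block.
    by have [<-|ji] := eqVneq l k; rewrite ?dfwithin// dfwithout.
  have [lk|lk] := eqVneq l k; last first.
    by rewrite hV; apply: eq_bigr => i _; rewrite andbF.
  rewrite hV (bigD1 j)//= [in RHS](bigD1 j)//= eqxx.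
  rewrite [_ + _ - _]addrAC subrr add0r addrC; congr (_ + _).
  by apply: eq_bigr => i /negPf; rewrite eq_sym => ->.
Qed.

Lemma dual_est_err s j l : table_sums s ->
  dual_est s j l - submxcol X j *m wstar =
  (q l)^-1 *: (Xb j l *m primal_err s l)
  - ((q l)^-1 *: dual_mem_err s j l - \sum_k dual_mem_err s j k).
Proof.
move=> [hU _]; rewrite /dual_est hU submxcol_mulmx /dual_mem_err sumrB.
rewrite /primal_err mulmxBr !scalerBr.
by apply/matrixP => r t; rewrite !mxE; ring.
Qed.

Lemma primal_est_err s j k : table_sums s ->
  primal_est s j k - vstar k =
  (p j)^-1 *: (m%:R^-1 *: ((Xb j k)^T *m dual_err s j))
  - ((p j)^-1 *: primal_mem_err s j k - \sum_i primal_mem_err s i k).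
Proof.
move=> [_ hV]; rewrite /primal_est hV /primal_mem_err sumrB -/(vstar k).
rewrite /dual_err mulmxBr !scalerBr.
by apply/matrixP => r t; rewrite !mxE; ring.
Qed.

(** A drawn block contributes p_i Gamma gamma_i = c_i + gamma_i times its new square, the left side
    of [dual_block_step]; an undrawn one keeps (1 - p_i) Gamma gamma_i times the old square. Adding
    c_i gives gamma_i (Gamma - 1), free of p_i. *)
Lemma dual_step_mean s i : table_sums s ->
  Gamma * gamma i * Emean (fun j l =>
    dotc (dual_err (step s j l) i) (dual_err (step s j l) i)) <=
  gamma i * (Gamma - 1) * dotc (dual_err s i) (dual_err s i)
  + dotc (\sum_k Xb i k *m primal_err s k) (dual_err s i)
  + (4 * c i)^-1 *
    (2 * \sum_k (q k)^-1 * dotc (Xb i k *m primal_err s k)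
                                (Xb i k *m primal_err s k)
     + 2 * \sum_k (q k)^-1 * dotc (dual_mem_err s i k) (dual_mem_err s i k)).
Proof.
move=> hs; set e := dual_err s i.
pose new l := dual_new s i l - submxcol astar i.
pose err l := dual_est s i l - submxcol X i *m wstar.
have -> : (fun j l =>
    dotc (dual_err (step s j l) i) (dual_err (step s j l) i)) =
    (fun j l => if j == i then dotc (new l) (new l) else dotc e e).
  apply/funext => j; apply/funext => l; rewrite /dual_err step_alpha.
  by case: eqP.
rewrite index_mean_row//.
have hl l : (c i + gamma i) * dotc (new l) (new l) <=
    c i * dotc e e + dotc (err l) e + (4 * c i)^-1 * dotc (err l) (err l).
  have := @dual_block_step R _ (f i) (gamma i) (c i) (sigma i)
    (submxcol X i *m wstar) (submxcol astar i) (submxcol (sg_alpha s) i)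
    (dual_new s i l) (dual_est s i l) (convex_f i) (smooth_f i).
  exact.
have hsum : (c i + gamma i) * \sum_l q l * dotc (new l) (new l) <=
    c i * dotc e e + dotc (\sum_l q l *: err l) e
    + (4 * c i)^-1 * \sum_l q l * dotc (err l) (err l).
  have -> : c i * dotc e e = \sum_l q l * (c i * dotc e e).
    by rewrite -mulr_suml q_sum1 mul1r.
  rewrite dotc_suml !mulr_sumr -!big_split/= ler_sum// => l _.
  by rewrite dotcZl; have := ler_wpM2l (ltW (q_gt0 l)) (hl l); lra.
have errE l : err l = _ := dual_est_err i l hs.
have := saga_estimator_mean (fun k => Xb i k *m primal_err s k)
  (dual_mem_err s i) q_gt0 q_sum1.
have := saga_estimator_variance (fun k => Xb i k *m primal_err s k)
  (dual_mem_err s i) q_gt0 q_sum1.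
rewrite -(eq_bigr _ (fun l _ => congr1 (fun v => q l *: v) (errE l))).
rewrite -(eq_bigr _ (fun l _ => congr1 (fun v => q l * dotc v v) (errE l))).
move=> hvar hmean; rewrite hmean in hsum.
have c4 : 0 <= (4 * c i)^-1 by rewrite invr_ge0 mulr_ge0// ltW.
have := ler_wpM2l c4 hvar.
have cE : c i + gamma i = gamma i * p i * Gamma by rewrite /c; ring.
have ceE : c i * dotc e e = gamma i * (p i * Gamma - 1) * dotc e e by [].
move: hsum; rewrite cE ceE; lra.
Qed.

Lemma primal_step_mean s k : table_sums s ->
  Gamma * lambda * Emean (fun j l =>
    dotc (primal_err (step s j l) k) (primal_err (step s j l) k)) <=
  lambda * (Gamma - 1) * dotc (primal_err s k) (primal_err s k)
  - dotc (\sum_i m%:R^-1 *: ((Xb i k)^T *m dual_err s i)) (primal_err s k)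
  + (4 * c' k)^-1 *
    (2 * \sum_i (p i)^-1 * dotc (m%:R^-1 *: ((Xb i k)^T *m dual_err s i))
                                (m%:R^-1 *: ((Xb i k)^T *m dual_err s i))
     + 2 * \sum_i (p i)^-1 *
         dotc (primal_mem_err s i k) (primal_mem_err s i k)).
Proof.
move=> hs; set e := primal_err s k.
pose new j := primal_new s j k - submxcol wstar k.
pose err j := primal_est s j k - vstar k.
have -> : (fun j l =>
    dotc (primal_err (step s j l) k) (primal_err (step s j l) k)) =
    (fun j l => if l == k then dotc (new j) (new j) else dotc e e).
  apply/funext => j; apply/funext => l; rewrite /primal_err step_w.
  by case: eqP.
rewrite index_mean_col//.
have hl j : (c' k + lambda) * dotc (new j) (new j) <=
    c' k * dotc e e - dotc (err j) e + (4 * c' k)^-1 * dotc (err j) (err j).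
  have := @primal_block_step R _ (g k) lambda (c' k) (tau k)
    (submxcol wstar k) (vstar k) (submxcol (sg_w s) k)
    (primal_new s j k) (primal_est s j k) (convex_g k) (strong_g k) (wstarE k).
  exact.
have hsum : (c' k + lambda) * \sum_j p j * dotc (new j) (new j) <=
    c' k * dotc e e - dotc (\sum_j p j *: err j) e
    + (4 * c' k)^-1 * \sum_j p j * dotc (err j) (err j).
  have -> : c' k * dotc e e = \sum_j p j * (c' k * dotc e e).
    by rewrite -mulr_suml p_sum1 mul1r.
  rewrite dotc_suml !mulr_sumr -sumrB -!big_split/= ler_sum// => j _.
  by rewrite dotcZl; have := ler_wpM2l (ltW (p_gt0 j)) (hl j); lra.
have errE j : err j = _ := primal_est_err j k hs.
have := saga_estimator_mean
  (fun i => m%:R^-1 *: ((Xb i k)^T *m dual_err s i))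
  (fun i => primal_mem_err s i k) p_gt0 p_sum1.
have := saga_estimator_variance
  (fun i => m%:R^-1 *: ((Xb i k)^T *m dual_err s i))
  (fun i => primal_mem_err s i k) p_gt0 p_sum1.
rewrite -(eq_bigr _ (fun j _ => congr1 (fun v => p j *: v) (errE j))).
rewrite -(eq_bigr _ (fun j _ => congr1 (fun v => p j * dotc v v) (errE j))).
move=> hvar hmean; rewrite hmean in hsum.
have c4 : 0 <= (4 * c' k)^-1 by rewrite invr_ge0 mulr_ge0// ltW.
have := ler_wpM2l c4 hvar.
have cE : c' k + lambda = lambda * q k * Gamma by rewrite /c'; ring.
have ceE : c' k * dotc e e = lambda * (q k * Gamma - 1) * dotc e e by [].
move: hsum; rewrite cE ceE; lra.
Qed.

(** Half the coefficients with which estimator errors enter the two mean step bounds; [mu] carries 1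
    / m because [sq_dist] weights dual errors by it. *)
Let mu i k := m%:R^-1 * (4 * c i)^-1 * (q k)^-1.
Let nu i k := (4 * c' k)^-1 * (p i)^-1.

Let mu_ge0 i k : 0 <= mu i k.
Proof.
have c0 := ltW (c_gt0 i); have q0 := ltW (q_gt0 k).
by rewrite /mu; apply: mulr_ge0; [apply: mulr_ge0|];
  rewrite invr_ge0 ?ler0n// mulr_ge0.
Qed.

Let nu_ge0 i k : 0 <= nu i k.
Proof.
have c0 := ltW (c'_gt0 k); have p0 := ltW (p_gt0 i).
by rewrite /nu; apply: mulr_ge0; rewrite invr_ge0// mulr_ge0.
Qed.

Definition sq_dist (s : state) :=
  lambda * \sum_k dotc (primal_err s k) (primal_err s k)
  + m%:R^-1 * \sum_i gamma i * dotc (dual_err s i) (dual_err s i).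

(** Also the value that [mem_sq] takes at (i, k) once that entry is refreshed. *)
Let est_sq (s : state) i k :=
  mu i k * dotc (Xb i k *m primal_err s k) (Xb i k *m primal_err s k)
  + nu i k * dotc (m%:R^-1 *: ((Xb i k)^T *m dual_err s i))
                  (m%:R^-1 *: ((Xb i k)^T *m dual_err s i)).

Let mem_sq (s : state) i k :=
  mu i k * dotc (dual_mem_err s i k) (dual_mem_err s i k)
  + nu i k * dotc (primal_mem_err s i k) (primal_mem_err s i k).

(* The estimator variance costs 2 mem_sq per step and refreshing the tables gains
   3 mem_sq; the surplus pays for the contraction since (p_i q_k)^-1 <= Gamma. *)
Definition lyapunov (s : state) :=
  Gamma * sq_dist s + 3 * \sum_i \sum_k (p i * q k)^-1 * mem_sq s i k.

Lemma Omega_sq_dist s :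
  Omega lambda gamma (sg_w s - wstar) (sg_alpha s - astar) = sq_dist s.
Proof.
rewrite /Omega /sq_dist norm2_sqr dotc_blocks; congr (_ * _ + _ * _).
  by apply: eq_bigr => k _; rewrite submxcolB.
by apply: eq_bigr => i _; rewrite norm2_sqr submxcolB.
Qed.

Lemma sq_dist_ge0 s : 0 <= sq_dist s.
Proof.
rewrite addr_ge0// mulr_ge0 ?invr_ge0 ?ler0n//; first exact: ltW.
  by apply: sumr_ge0 => k _; exact: dotc_ge0.
by apply: sumr_ge0 => i _; rewrite mulr_ge0 ?dotc_ge0// ltW.
Qed.

Let mem_sq_ge0 s i k : 0 <= mem_sq s i k.
Proof. by rewrite addr_ge0// mulr_ge0// dotc_ge0. Qed.

Lemma sq_dist_lyapunov s : Gamma * sq_dist s <= lyapunov s.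
Proof.
rewrite lerDl mulr_ge0// sumr_ge0// => i _; rewrite sumr_ge0// => k _.
by rewrite mulr_ge0// invr_ge0 ltW// mulr_gt0.
Qed.

(** The spectral hypotheses bound |X_ik|^2 / (4 c_i q_k) by lambda / 18, since 2 / (9 * 4) = 1 / 18,
    and similarly for the primal weights. Each primal error occurs in m rows and each dual error in
    n columns: the former is offset by the 1 / m in [mu], the latter by the factor n in the second
    bound on Gamma. *)
Lemma est_sq_le s : \sum_i \sum_k est_sq s i k <= sq_dist s / 18.
Proof.
have mR : 0 < m%:R :> R by rewrite ltr0n.
have nR : 0 < n%:R :> R by rewrite ltr0n.
have hprim i k : mu i k * dotc (Xb i k *m primal_err s k)
    (Xb i k *m primal_err s k) <=
    m%:R^-1 * (lambda / 18 * dotc (primal_err s k) (primal_err s k)).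
  have pos : 0 < 4 * c i * q k.
    by apply: mulr_gt0 => //; apply: mulr_gt0; rewrite ?c_gt0.
  have := dotc_spectral (Xb i k) (primal_err s k).
  move/(ler_wpM2l (mu_ge0 i k)) => /le_trans; apply.
  rewrite !mulrA ler_wpM2r ?dotc_ge0// /mu -!mulrA ler_wpM2l ?invr_ge0 ?ler0n//.
  rewrite mulrA -invfM mulrC ler_pdivrMr//.
  by have := spectral_dual i k; lra.
have hdual i k : nu i k * dotc (m%:R^-1 *: ((Xb i k)^T *m dual_err s i))
    (m%:R^-1 *: ((Xb i k)^T *m dual_err s i)) <=
    n%:R^-1 * (m%:R^-1 * (gamma i / 18 * dotc (dual_err s i) (dual_err s i))).
  have pos : 0 < 4 * c' k * p i * m%:R.
    do 2!(apply: mulr_gt0 => //); apply: mulr_gt0; rewrite ?c'_gt0//.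
  rewrite dotcZl dotcZr; have hX := dotc_spectral_tr (Xb i k) (dual_err s i).
  have w0 : 0 <= nu i k * m%:R^-1 * m%:R^-1.
    by do 2!(apply: mulr_ge0; last by rewrite invr_ge0 ler0n).
  rewrite [leLHS](_ : _ = nu i k * m%:R^-1 * m%:R^-1 *
      dotc ((Xb i k)^T *m dual_err s i) ((Xb i k)^T *m dual_err s i)); last by ring.
  apply: le_trans (ler_wpM2l w0 hX) _.
  rewrite !mulrA ler_wpM2r ?dotc_ge0//.
  rewrite (_ : n%:R^-1 / m%:R * gamma i / 18 =
    gamma i / 18 / (n%:R * m%:R)); last first.
    by rewrite invfM; ring.
  rewrite ler_pdivlMr ?mulr_gt0// /nu.
  rewrite [leLHS](_ : _ = (n%:R * spectral_norm (Xb i k) ^+ 2) /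
    (4 * c' k * p i * m%:R)); last first.
    by field; rewrite !gt_eqF.
  rewrite ler_pdivrMr//.
  by have := spectral_primal i k; lra.
have sm (x : R) : \sum_(i < m) m%:R^-1 * x = x.
  rewrite -mulr_sumr sumr_const card_ord -[x *+ m]mulr_natl mulrA.
  by rewrite mulVf ?mul1r// gt_eqF.
have sn (x : R) : \sum_(k < n) n%:R^-1 * x = x.
  rewrite -mulr_sumr sumr_const card_ord -[x *+ n]mulr_natl mulrA.
  by rewrite mulVf ?mul1r// gt_eqF.
rewrite (_ : sq_dist s / 18 =
  \sum_(i < m) m%:R^-1 *
    \sum_k lambda / 18 * dotc (primal_err s k) (primal_err s k) +
  \sum_i \sum_(k < n) n%:R^-1 *
    (m%:R^-1 * (gamma i / 18 * dotc (dual_err s i) (dual_err s i)))); last first.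
  rewrite sm (eq_bigr _ (fun i _ =>
    sn (m%:R^-1 * (gamma i / 18 * dotc (dual_err s i) (dual_err s i))))).
  rewrite -!mulr_sumr /sq_dist mulrDl; congr (_ + _); first by ring.
  rewrite -mulrA mulr_suml; congr (_ * _); apply: eq_bigr => i _; ring.
under [X in _ <= X + _]eq_bigr do rewrite mulr_sumr.
rewrite -big_split/= ler_sum// => i _; rewrite -big_split/= ler_sum// => k _.
by rewrite lerD.
Qed.

(** Initially [mem_sq] equals [est_sq] and the weights are at most Gamma, so the factor is 1 + 3 /
    18, below 4 / 3. *)
Lemma lyapunov_init w0 a0 :
  lyapunov (saga_init X w0 a0) <= 4 / 3 * Gamma * sq_dist (saga_init X w0 a0).
Proof.
set s := saga_init X w0 a0.
have memE i k : mem_sq s i k = est_sq s i k.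
  have hU : dual_mem_err s i k = Xb i k *m primal_err s k.
    by rewrite /dual_mem_err mulmxBr.
  have hV : primal_mem_err s i k = m%:R^-1 *: ((Xb i k)^T *m dual_err s i).
    by rewrite /primal_mem_err /= linearZ/= trmx_mul trmxK mulmxBr scalerBr.
  by rewrite /mem_sq hU hV.
have : \sum_i \sum_k (p i * q k)^-1 * mem_sq s i k <=
    Gamma * \sum_i \sum_k est_sq s i k.
  rewrite mulr_sumr ler_sum// => i _; rewrite mulr_sumr ler_sum// => k _.
  by rewrite -memE ler_wpM2r.
have := ler_wpM2l (ltW Gamma_gt0) (est_sq_le s).
have := mulr_ge0 (ltW Gamma_gt0) (sq_dist_ge0 s).
rewrite /lyapunov; lra.
Qed.

(** Both sides are the bilinear form of X in the dual and primal errors, divided by m; it enters the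
    two step bounds with opposite signs. *)
Lemma cross_terms_cancel s :
  m%:R^-1 * \sum_i dotc (\sum_k Xb i k *m primal_err s k) (dual_err s i) =
  \sum_k dotc (\sum_i m%:R^-1 *: ((Xb i k)^T *m dual_err s i))
              (primal_err s k).
Proof.
under eq_bigr do rewrite dotc_suml.
rewrite exchange_big mulr_sumr; apply: eq_bigr => k _.
rewrite dotc_suml mulr_sumr; apply: eq_bigr => i _.
by rewrite dotcZl -dotc_mulmx dotcC.
Qed.

Lemma sq_dist_mean s : table_sums s ->
  Gamma * Emean (fun j l => sq_dist (step s j l)) <=
  (Gamma - 1) * sq_dist s + 2 * \sum_i \sum_k est_sq s i k
  + 2 * \sum_i \sum_k mem_sq s i k.
Proof.
move=> hs; rewrite /sq_dist index_meanD !index_meanZ !index_mean_sum.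
under [X in _ + _ * X]eq_bigr do rewrite index_meanZ.
have hP := @ler_sum _ _ (index_enum 'I_n) xpredT _ _
  (fun k _ => primal_step_mean k hs).
have hD := @ler_sum _ _ (index_enum 'I_m) xpredT _ _
  (fun i _ => dual_step_mean i hs).
have m0 : 0 <= m%:R^-1 :> R by rewrite invr_ge0 ler0n.
have {hD} hD := ler_wpM2l m0 hD.
rewrite -mulr_sumr -mulrA in hP.
have DE (F : 'I_m -> R) : m%:R^-1 * (\sum_i Gamma * gamma i * F i) =
    Gamma * (m%:R^-1 * \sum_i gamma i * F i).
  rewrite [in RHS]mulrCA; congr (_ * _); rewrite mulr_sumr; apply: eq_bigr => i _.
  by rewrite mulrA.
rewrite DE in hD.
rewrite mulrDr; apply: le_trans (lerD hP hD) _.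
rewrite !big_split/= sumrN ![m%:R^-1 * (_ + _)]mulrDr cross_terms_cancel.
rewrite /est_sq /mem_sq.
have split2 (a b : 'I_m -> 'I_n -> R) : \sum_i \sum_k (a i k + b i k) =
    \sum_i \sum_k a i k + \sum_i \sum_k b i k.
  by rewrite -big_split; apply: eq_bigr => i _; rewrite -big_split.
rewrite !split2.
have dualE (a : 'I_m -> 'I_n -> R) (b : 'I_m -> 'I_n -> R) :
    m%:R^-1 * \sum_i (4 * c i)^-1 *
      (2 * \sum_k (q k)^-1 * a i k + 2 * \sum_k (q k)^-1 * b i k) =
    2 * (\sum_i \sum_k mu i k * a i k) + 2 * (\sum_i \sum_k mu i k * b i k).
  rewrite !mulr_sumr -big_split; apply: eq_bigr => i _ /=.
  rewrite !mulr_sumr -!big_split/= !mulr_sumr; apply: eq_bigr => k _.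
  by rewrite /mu; ring.
have primalE (a : 'I_m -> 'I_n -> R) (b : 'I_m -> 'I_n -> R) :
    \sum_k (4 * c' k)^-1 *
      (2 * \sum_i (p i)^-1 * a i k + 2 * \sum_i (p i)^-1 * b i k) =
    2 * (\sum_i \sum_k nu i k * a i k) + 2 * (\sum_i \sum_k nu i k * b i k).
  rewrite ![\sum_(i < m) \sum_(k < n) _]exchange_big.
  rewrite !mulr_sumr -big_split; apply: eq_bigr => k _ /=.
  rewrite !mulr_sumr -!big_split/= !mulr_sumr; apply: eq_bigr => i _.
  by rewrite /nu; ring.
rewrite dualE primalE.
have -> : \sum_k lambda * (Gamma - 1) * dotc (primal_err s k) (primal_err s k)
    = lambda * (Gamma - 1) * \sum_k dotc (primal_err s k) (primal_err s k).
  by rewrite mulr_sumr.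
have -> : \sum_i gamma i * (Gamma - 1) * dotc (dual_err s i) (dual_err s i)
    = (Gamma - 1) * \sum_i gamma i * dotc (dual_err s i) (dual_err s i).
  by rewrite mulr_sumr; apply: eq_bigr => i _; ring.
lra.
Qed.

(** Entry (i, k) is refreshed with probability p_i q_k, which its weight cancels exactly. *)
Lemma mem_sq_mean s :
  Emean (fun j l => \sum_i \sum_k (p i * q k)^-1 * mem_sq (step s j l) i k) =
  \sum_i \sum_k est_sq s i k - \sum_i \sum_k mem_sq s i k
  + \sum_i \sum_k (p i * q k)^-1 * mem_sq s i k.
Proof.
rewrite index_mean_sum -sumrB -big_split; apply: eq_bigr => i _ /=.
rewrite index_mean_sum -sumrB -big_split; apply: eq_bigr => k _ /=.
rewrite index_meanZ.
have -> : (fun j l => mem_sq (step s j l) i k) = (fun j l =>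
    if (j == i) && (l == k) then est_sq s i k else mem_sq s i k).
  apply/funext => j; apply/funext => l.
  rewrite /mem_sq /est_sq /dual_mem_err /primal_mem_err step_U step_V.
  by case: ifP => // _; rewrite /primal_err /dual_err !mulmxBr !scalerBr.
rewrite index_mean_entry//; field.
by rewrite !gt_eqF.
Qed.

(** Fresh errors are charged 2 + 3 times and cost at most 5 / 18 of [sq_dist], within the available
    2 / 3. Stored errors are left with coefficient 2 - 3 = -1, which by [hM] covers the decrease
    required of the table part. *)
Lemma lyapunov_mean s : table_sums s ->
  Emean (fun j l => lyapunov (step s j l)) <=
  (1 - 1 / (3 * Gamma)) * lyapunov s.
Proof.
move=> hs; rewrite /lyapunov index_meanD !index_meanZ mem_sq_mean.
have := sq_dist_mean hs; have := est_sq_le s; have := sq_dist_ge0 s.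
have hM : (1 / (3 * Gamma)) *
    (3 * \sum_i \sum_k (p i * q k)^-1 * mem_sq s i k) <=
    \sum_i \sum_k mem_sq s i k.
  rewrite mulr_sumr mulr_sumr ler_sum// => i _.
  rewrite mulr_sumr mulr_sumr ler_sum// => k _.
  rewrite (_ : _ * _ = (p i * q k)^-1 / Gamma * mem_sq s i k).
    by rewrite ler_piMl// ler_pdivrMr// mul1r.
  by rewrite invfM; field; rewrite !gt_eqF.
have GE : 1 / (3 * Gamma) * (Gamma * sq_dist s) = sq_dist s / 3.
  by field; rewrite gt_eqF.
move: hM GE.
move: (Emean _) (sq_dist s) (1 / (3 * Gamma)) => E S r.
lra.
Qed.

End saga_contraction.

(** * Expectation over the drawn indices *)

(* Most recent draw first. *)
Fixpoint index_path (T : Type) m n (J : nat -> T -> 'I_m) (K : nat -> T -> 'I_n)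
    (t : nat) (x : T) : seq ('I_m * 'I_n) :=
  if t is t'.+1 then (J t' x, K t' x) :: index_path J K t' x else [::].

Section index_paths.
Context {disp : measure_display} {T : measurableType disp} {R : realType}.
Variables (P : probability T R) (m n : nat) (p : 'I_m -> R) (q : 'I_n -> R).
Variables (J : nat -> T -> 'I_m) (K : nat -> T -> 'I_n).
Hypothesis JK : index_sampling P p q J K.
Hypothesis p_ge0 : forall i, 0 <= p i.
Hypothesis q_ge0 : forall k, 0 <= q k.

(** With the latest draw at the head, the length of the tail is the time of the head. *)
Fixpoint path_event (c : seq ('I_m * 'I_n)) : set T :=
  if c is z :: c' then
    J (size c') @^-1` [set z.1] `&` (K (size c') @^-1` [set z.2] `&`
      path_event c')
  else setT.

Definition path_weight (c : seq ('I_m * 'I_n)) : R :=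
  \prod_(z <- c) (p z.1 * q z.2).

Definition path_mean t (h : seq ('I_m * 'I_n) -> R) : R :=
  \sum_(c : t.-tuple ('I_m * 'I_n)%type) path_weight c * h c.

Lemma size_index_path t x : size (index_path J K t x) = t.
Proof. by elim: t => //= t ->. Qed.

Lemma path_eventP c x : path_event c x <-> index_path J K (size c) x = c.
Proof.
elim: c => [|[j k] c IH]; first by split.
split=> [[/= -> [-> /IH ->]]//|/= [jE kE cE]].
by do ![split => //]; exact/IH.
Qed.

Lemma index_eventJ t j : index_events J K (inl t) (J t @^-1` [set j]).
Proof. by exists [set j]. Qed.

Lemma index_eventK t k : index_events J K (inr t) (K t @^-1` [set k]).
Proof. by exists [set k]. Qed.

Lemma path_event_measurable c : measurable (path_event c).
Proof.
have [mJK _ _ _] := JK.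
elim: c => [|z c IH] /=; first exact: measurableT.
apply: measurableI; first exact: mJK (index_eventJ _ _).
by apply: measurableI => //; exact: mJK (index_eventK _ _).
Qed.

Let time (s : nat + nat) := match s with inl t => t | inr t => t end.

(** The additional family of later events makes the induction work: the two draws at the head join
    the family, and the empty path is mutual independence itself. *)
Lemma path_event_indep c (F : {fset (nat + nat)%type}) (A : nat + nat -> set T) :
  (forall s, s \in F -> index_events J K s (A s)) ->
  (forall s, s \in F -> (size c <= time s)%N) ->
  P (path_event c `&` \bigcap_(s in [set` F]) A s) =
  ((path_weight c)%:E * \prod_(s <- F) P (A s))%E.
Proof.
have [mJK PJ PK ind] := JK.
elim: c F A => [|z c IH] F A hA hF.
  by rewrite /path_weight big_nil mul1e setTI; exact: ind.
(* The family extended by the two draws at the head; their positions are free, because members of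
   [F] occur strictly after time [size c]. *)
pose A' s := if s == inl (size c) then J (size c) @^-1` [set z.1]
  else if s == inr (size c) then K (size c) @^-1` [set z.2] else A s.
have Fl : inl (size c) \notin F.
  by apply/negP => /hF /=; rewrite ltnn.
have Fr : inr (size c) \notin F.
  by apply/negP => /hF /=; rewrite ltnn.
have Fl' : inl (size c) \notin (inr (size c) |` F)%fset.
  by rewrite !inE negb_or Fl.
have A'F s : s \in F -> A' s = A s.
  move=> sF; rewrite /A'; case: eqP => [sE|_]; first by rewrite -sE sF in Fl.
  by case: eqP => [sE|//]; rewrite -sE sF in Fr.
have hA' s : s \in (inl (size c) |` (inr (size c) |` F))%fset ->
    index_events J K s (A' s).
  rewrite !inE => /or3P[/eqP->|/eqP->|sF].
  - by rewrite /A' eqxx; exact: index_eventJ.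
  - by rewrite /A' /= eqxx; exact: index_eventK.
  - by rewrite A'F//; exact: hA.
have hF' s : s \in (inl (size c) |` (inr (size c) |` F))%fset ->
    (size c <= time s)%N.
  by rewrite !inE => /or3P[/eqP->|/eqP->|/hF /ltnW].
have := IH _ A' hA' hF'.
rewrite !set_fsetU1 !bigcap_setU1 !big_fsetU1// /A' /= !eqxx PJ PK.
have -> : path_weight (z :: c) = path_weight c * p z.1 * q z.2.
  by rewrite /path_weight big_cons; ring.
rewrite -/A' (_ : \bigcap_(s in [set` F]) A' s =
    \bigcap_(s in [set` F]) A s); last first.
  by apply: eq_bigcapr => s /= /A'F.
rewrite (_ : (\prod_(s <- F) P (A' s) = \prod_(s <- F) P (A s))%E); last first.
  by apply: eq_big_seq => s /A'F ->.
rewrite !EFinM !muleA => <-.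
congr (P _); rewrite [in RHS]setICA [in RHS]setIA [in RHS]setICA !setIA.
by congr (_ `&` _ `&` _); exact: setIC.
Qed.

Lemma path_event_prob c : P (path_event c) = (path_weight c)%:E.
Proof.
have := @path_event_indep c fset0 (fun=> setT).
rewrite big_nil mule1 => <- //.
by rewrite set_fset0 bigcap_set0 setIT.
Qed.

(** The integrand is a finite combination of indicators of the disjoint path events; nonnegativity
    of [h] lets the integral pass through the sum. *)
Lemma expectation_path t (h : seq ('I_m * 'I_n) -> R) : (forall c, 0 <= h c) ->
  ('E_P[fun x => h (index_path J K t x)] = (path_mean t h)%:E)%E.
Proof.
move=> h0; rewrite unlock.
transitivity (\int[P]_x (\sum_(c : t.-tuple ('I_m * 'I_n)%type)
    (h c)%:E * (\1_(path_event c) x)%:E))%E.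
  apply: eq_integral => x _.
  have sz : size (index_path J K t x) == t by rewrite size_index_path.
  rewrite (bigD1 (Tuple sz))//= big1 ?adde0 => [|c cx].
    rewrite indicE mem_set ?mule1//; apply/path_eventP.
    by rewrite size_index_path.
  rewrite indicE memNset ?mule0//; apply: contraNnot cx => /path_eventP.
  by rewrite size_tuple => cE; apply/eqP/val_inj; rewrite /= cE.
rewrite ge0_integral_sum//=.
- rewrite /path_mean -sumEFin; apply: eq_bigr => c _.
  rewrite ge0_integralZl_EFin//=.
  + rewrite integral_indic//; last exact: path_event_measurable.
    by rewrite setIT mulrC EFinM; congr (_ * _)%E; exact: path_event_prob.
  + by apply/measurable_EFinP; exact: measurable_indic (path_event_measurable _).
- move=> c; apply: measurable_funeM.
  by apply/measurable_EFinP; exact: measurable_indic (path_event_measurable _).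
- by move=> c x _; rewrite mule_ge0 ?lee_fin.
Qed.

Lemma path_mean0 h : path_mean 0 h = h [::].
Proof.
rewrite /path_mean (big_pred1 [tuple]) => [|c]; last first.
  by apply/esym/eqP; exact: tuple0.
by rewrite /path_weight big_nil mul1r.
Qed.

(** Splitting off the head, the latest draw, leaves as inner mean the expectation conditional on the
    earlier draws. *)
Lemma path_meanS t h :
  path_mean t.+1 h =
  path_mean t (fun c => index_mean p q (fun j l => h ((j, l) :: c))).
Proof.
rewrite /path_mean.
rewrite (reindex (fun zc : ('I_m * 'I_n) * t.-tuple ('I_m * 'I_n)%type =>
   [tuple of zc.1 :: zc.2])) /=; last first.
  exists (fun c => (thead c, [tuple of behead c])) => [[z c] _ | c _] /=.
    by congr (_, _); apply: val_inj.
  by rewrite [in RHS](tuple_eta c).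
rewrite -(pair_bigA _ (fun z (c : t.-tuple _) =>
  path_weight (z :: c) * h (z :: c))) /=.
rewrite exchange_big; apply: eq_bigr => c _.
rewrite /index_mean pair_bigA mulr_sumr; apply: eq_bigr => -[j l] _ /=.
by rewrite /path_weight big_cons; ring.
Qed.

Lemma path_weight_ge0 c : 0 <= path_weight c.
Proof. by apply: prodr_ge0 => z _; rewrite mulr_ge0. Qed.

Lemma path_mean_le t h h' : (forall c, h c <= h' c) ->
  path_mean t h <= path_mean t h'.
Proof.
by move=> hh; apply: ler_sum => c _; rewrite ler_wpM2l ?path_weight_ge0.
Qed.

Lemma path_meanZ t a h : path_mean t (fun c => a * h c) = a * path_mean t h.
Proof.
by rewrite /path_mean mulr_sumr; apply: eq_bigr => c _; rewrite mulrCA.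
Qed.

Lemma path_mean_geometric (r : R) h : 0 <= r ->
  (forall c, index_mean p q (fun j l => h ((j, l) :: c)) <= r * h c) ->
  forall t, path_mean t h <= r ^+ t * h [::].
Proof.
move=> r0 hr; elim=> [|t IH]; first by rewrite path_mean0 expr0 mul1r.
rewrite path_meanS (le_trans (path_mean_le _ hr))// path_meanZ exprS -mulrA.
by rewrite ler_wpM2l.
Qed.

End index_paths.

Lemma saga_iter_path (R : realType) (m n : nat) (N : 'I_m -> nat)
    (d : 'I_n -> nat) (X : 'M[R]_(\sum_i N i, \sum_k d k))
    (f : forall i, 'cV[R]_(N i) -> R) (g : forall k, 'cV[R]_(d k) -> R)
    (p : 'I_m -> R) (q : 'I_n -> R) (sigma : 'I_m -> R) (tau : 'I_n -> R)
    w0 alpha0 (T : Type) (J : nat -> T -> 'I_m) (K : nat -> T -> 'I_n) x t :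
  saga_iter X f g p q sigma tau w0 alpha0 (J^~ x) (K^~ x) t =
  foldr (fun z s => saga_step X f g p q sigma tau s z.1 z.2)
    (saga_init X w0 alpha0) (index_path J K t x).
Proof. by elim: t => //= t ->. Qed.

Lemma distribution_le1 (R : realType) n (p : 'I_n -> R) i :
  distribution_on p -> p i <= 1.
Proof.
move=> [p0 <-]; rewrite (bigD1 i)//= lerDl sumr_ge0// => j _; exact: ltW.
Qed.

Theorem theorem3 (R : realType) (m n : nat) (N : 'I_m -> nat) (d : 'I_n -> nat)
    (hm : (0 < m)%N) (hn : (0 < n)%N)
    (hN : forall i, (0 < N i)%N) (hd : forall k, (0 < d k)%N)
    (X : 'M[R]_(\sum_i N i, \sum_k d k))
    (f : forall i, 'cV[R]_(N i) -> R) (g : forall k, 'cV[R]_(d k) -> R)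
    (lambda : R) (gamma : 'I_m -> R)
    (hlambda : 0 < lambda) (hgamma : forall i, 0 < gamma i)
    (hf : forall i, convex (f i) /\ smooth (1 / gamma i) (f i))
    (hg : strongly_convex lambda (separable g))
    (wstar : 'cV[R]_(\sum_k d k)) (astar : 'cV[R]_(\sum_i N i))
    (hstar : saddle_point (lagrangian X f g) wstar astar)
    (p : 'I_m -> R) (q : 'I_n -> R)
    (hp : distribution_on p) (hq : distribution_on q)
    (Gamma : R)
    (hGamma : forall i k,
      [/\ 1 / p i * (1 + 9 * spectral_norm (submxblock X i k) ^+ 2
                         / (2 * q k * lambda * gamma i)) <= Gamma,
          1 / q k * (1 + 9 * n%:R * spectral_norm (submxblock X i k) ^+ 2
                         / (2 * p i * m%:R * lambda * gamma i)) <= Gamma &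
          1 / (p i * q k) <= Gamma])
    (sigma : 'I_m -> R) (tau : 'I_n -> R)
    (hpG : forall i, 1 < p i * Gamma) (hqG : forall k, 1 < q k * Gamma)
    (hsigma : forall i, sigma i = 1 / (2 * gamma i * (p i * Gamma - 1)))
    (htau : forall k, tau k = 1 / (2 * lambda * (q k * Gamma - 1)))
    (w0 : 'cV[R]_(\sum_k d k)) (alpha0 : 'cV[R]_(\sum_i N i))
    (disp : measure_display) (T : measurableType disp) (P : probability T R)
    (J : nat -> T -> 'I_m) (K : nat -> T -> 'I_n)
    (hJK : index_sampling P p q J K) (t : nat) (ht : (0 < t)%N) :
  let iter (x : T) :=
    saga_iter X f g p q sigma tau w0 alpha0 (J^~ x) (K^~ x) t in
  ('E_P[fun x => Omega lambda gamma (sg_w (iter x) - wstar)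
                                    (sg_alpha (iter x) - astar)]
   <= ((1 - 1 / (3 * Gamma)) ^+ t * (4 / 3)
       * Omega lambda gamma (w0 - wstar) (alpha0 - astar))%:E)%E.
Proof.
cbv zeta.
have [p0 p1] := hp; have [q0 q1] := hq.
pose i0 := Ordinal hm.
have G1 : 1 < Gamma.
  apply: lt_le_trans (hpG i0) _; rewrite ger_pMl ?(distribution_le1 _ hp)//.
  by rewrite -(pmulr_rgt0 _ (p0 i0)) (lt_trans ltr01).
have G0 : 0 < Gamma by rewrite (lt_trans ltr01).
have cf i : convex (f i) := (hf i).1.
have df i x : differentiable (f i) x := (hf i).2.1 x.
have astarE i := (saddle_conjugate hm cf df hstar i).1.
have wstarE := saddle_primal hm cf df hstar.
have gk k := strongly_convex_block k hg wstarE.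
have sf i : smooth (1 / gamma i) (f i) := (hf i).2.
have cg k : convex (g k) := (gk k).1.
have sg k := (gk k).2.
have {}wstarE k : subdifferential (g k) (submxcol wstar k)
    (- \sum_i m%:R^-1 *: ((submxblock X i k)^T *m submxcol astar i)).
  suff <- : submxcol (- (m%:R^-1 *: (X^T *m astar))) k =
      - \sum_i m%:R^-1 *: ((submxblock X i k)^T *m submxcol astar i).
    exact: subdifferential_block.
  rewrite submxcolN; congr (- _).
  rewrite -scaler_sumr -submxcol_trmulmx.
  by apply/matrixP => ? ?; rewrite !mxE.
have c0 i : 0 < gamma i * (p i * Gamma - 1) by rewrite mulr_gt0// subr_gt0.
have c'0 k : 0 < lambda * (q k * Gamma - 1) by rewrite mulr_gt0// subr_gt0.
have sigmaE i : sigma i = (2 * (gamma i * (p i * Gamma - 1)))^-1.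
  by rewrite hsigma mul1r mulrA.
have tauE k : tau k = (2 * (lambda * (q k * Gamma - 1)))^-1.
  by rewrite htau mul1r mulrA.
have mR : 0 < m%:R :> R by rewrite ltr0n.
have nR : 0 < n%:R :> R by rewrite ltr0n.
have spectral_dual i k : 9 * spectral_norm (submxblock X i k) ^+ 2 <=
    2 * lambda * q k * (gamma i * (p i * Gamma - 1)).
  have [h _ _] := hGamma i k; move: h.
  rewrite mul1r ler_pdivrMl// -lerBrDl ler_pdivrMr; last first.
    by rewrite !mulr_gt0.
  by lra.
have spectral_primal i k : 9 * n%:R * spectral_norm (submxblock X i k) ^+ 2 <=
    2 * m%:R * gamma i * p i * (lambda * (q k * Gamma - 1)).
  have [_ h _] := hGamma i k; move: h.
  rewrite mul1r ler_pdivrMl// -lerBrDl ler_pdivrMr; last first.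
    by rewrite !mulr_gt0.
  by lra.
have pqG i k : (p i * q k)^-1 <= Gamma.
  by have [_ _] := hGamma i k; rewrite mul1r.
pose s0 := saga_init X w0 alpha0.
pose st c := foldr (fun z s => saga_step X f g p q sigma tau s z.1 z.2) s0 c.
pose r := 1 - 1 / (3 * Gamma).
have r0 : 0 <= r.
  by rewrite subr_ge0 ler_pdivrMr ?mulr_gt0// mul1r; lra.
(* The invariant holds along every list of indices, so the contraction needs no exceptional
   event. *)
have tab c : table_sums (st c).
  elim: c => [|z c IH]; first exact: table_sums_init.
  exact: table_sums_step.
pose L c := lyapunov X lambda gamma p q Gamma wstar astar (st c).
have geo c : index_mean p q (fun j l => L ((j, l) :: c)) <= r * L c.
  rewrite /L /=.
  exact: lyapunov_mean.
pose S c := sq_dist lambda gamma wstar astar (st c).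
have S0 c : 0 <= S c by exact: sq_dist_ge0.
rewrite (_ : (fun x => _) = (fun x => S (index_path J K t x))); last first.
  by apply/funext => x; rewrite saga_iter_path Omega_sq_dist.
have pge0 i := ltW (p0 i); have qge0 k := ltW (q0 k).
rewrite (expectation_path hJK)// lee_fin.
(* Scaling by Gamma brings the left side below the mean of [lyapunov]; the factor is cancelled by
   the Gamma in [lyapunov_init]. *)
rewrite -(ler_pM2l G0) -path_meanZ.
apply: (@le_trans _ _ (r ^+ t * L [::])).
  apply: (@le_trans _ _ (path_mean p q t L)).
    by apply: path_mean_le => // c; exact: sq_dist_lyapunov.
  exact: path_mean_geometric.
have -> : Omega lambda gamma (w0 - wstar) (alpha0 - astar) = S [::].
  exact: (Omega_sq_dist _ _ _ _ s0).
have -> : Gamma * (r ^+ t * (4 / 3) * S [::]) =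
    r ^+ t * (4 / 3 * Gamma * S [::]) by ring.
rewrite ler_wpM2l ?exprn_ge0//.
exact: lyapunov_init.
Qed.
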